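(* Let $T>0$, $L>0$, and let $W^T\in\widetilde H^0$ be such that for every $T^*>T$ $$\int_0^\infty e^{\frac{x^2}{4T^*}}\,\bigl|W^T(x)\bigr|\,dx\le L\sqrt{\frac{T^*}{\pi}}\,\ln\frac{\sqrt{T^*}+\sqrt{T}}{\sqrt{T^*}-\sqrt{T}}.$$ Let $$\omega_n=\frac{n!}{(2n+1)!}\int_0^\infty x^{2n+1}W^T(x)\,dx,\qquad n=0,1,2,\dots.$$ If for each $N\in\mathbb N$ there exists $v_N\in L^\infty(0,T)$ such that $\|v_N\|_{L^\infty(0,T)}\le L$ and $$\int_0^T\xi^n v_N(\xi)\,d\xi=\omega_n,\qquad n=0,1,\dots,N,$$ then $W^T\in\overline{\mathcal R_T^L(0)}$, where the closure is taken in $\widetilde H^0$.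
   Context: $\widetilde H^0$ denotes the closed subspace of all odd functions in $L^2(\mathbb R)$, with the $L^2(\mathbb R)$ norm. States and controls are over one fixed scalar field. For $T>0$ and $L>0$ define $$\mathcal R_T^L(0)=\Big\{W^T\in\widetilde H^0 : \exists v\in L^\infty(0,T),\ \|v\|_{L^\infty(0,T)}\le L,\ W^T(x)=\sqrt{\tfrac{2}{\pi}}\,x\int_0^T e^{-\frac{x^2}{4\xi}}\frac{v(\xi)}{(2\xi)^{3/2}}\,d\xi\Big\}$$ (equality of functions of $x$ in $L^2(\mathbb R)$). This is the set of states reachable in time $T$ from the zero state for the control system $W_t=W_{xx}-2u\delta'$, $x\in\mathbb R$, $t\in(0,T)$, $W(\cdot,0)=0$, with controls $u\in L^\infty(0,T)$ satisfying $\|u\|_{L^\infty(0,T)}\le L$ (where $v(\xi)=u(T-\xi)$). *)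

(* Defs.v *)
From HB Require Import structures.
From mathcomp Require Import all_boot all_order all_algebra.
From mathcomp Require Import all_classical all_reals all_analysis.
From mathcomp Require Import complex.
Set Implicit Arguments.
Unset Strict Implicit.
Unset Printing Implicit Defensive.
Import Order.TTheory GRing.Theory Num.Theory.
Import numFieldNormedType.Exports.
Import Normc.
Local Open Scope classical_set_scope.
Local Open Scope ring_scope.
Local Open Scope complex_scope.

(* States and controls take their values in one scalar field, real or complex.
   Both cases are handled inside R[i]: over the real scalars, values are
   required to have zero imaginary part.  Elements of L^2 and L^oo are given by
   representatives; equalities between them are almost everywhere. *)
Inductive scalar_field := RealScalars | ComplexScalars.

Definition scalar_in (R : realType) (K : scalar_field) (z : R[i]) : Prop :=
  match K with
  | RealScalars => complex.Im z = 0
  | ComplexScalars => True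
  end.

(* R[i] carries no Borel structure in the library: measurability and
   integration are componentwise. *)
Definition Cmeasurable (R : realType) (D : set R) (f : R -> R[i]) : Prop :=
  measurable_fun D (fun x => complex.Re (f x)) /\
  measurable_fun D (fun x => complex.Im (f x)).

Definition Cintegral (R : realType) (D : set R) (f : R -> R[i]) : R[i] :=
  (\int[@lebesgue_measure R]_(x in D) complex.Re (f x)) +i*
  (\int[@lebesgue_measure R]_(x in D) complex.Im (f x)).

Definition norm_L2 (R : realType) (f : R -> R[i]) : \bar R :=
  ('N[@lebesgue_measure R]_2%:E[EFin \o (@normc R) \o f])%E.

(* The norm on (0, T) is that of the extension of v by zero. *)
Definition norm_Loo (R : realType) (T : R) (v : R -> R[i]) : \bar R :=
  ('N[@lebesgue_measure R]_+oo[(EFin \o (@normc R) \o v) \_ `]0%R, T[])%E.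

Definition Loo (R : realType) (K : scalar_field) (T : R) : set (R -> R[i]) :=
  [set v | [/\ forall t, scalar_in K (v t), Cmeasurable `]0, T[ v &
               (norm_Loo T v < +oo)%E]].

Definition odd_L2 (R : realType) (K : scalar_field) : set (R -> R[i]) :=
  [set W | [/\ forall x, scalar_in K (W x), Cmeasurable setT W,
               (norm_L2 W < +oo)%E &
               {ae @lebesgue_measure R, forall x, W (- x) = - W x}]].

Definition final_state (R : realType) (T : R) (v : R -> R[i]) (x : R) : R[i] :=
  (Num.sqrt (2 / pi) * x)%:C *
  Cintegral `]0, T[
    (fun xi => (expR (- (x ^+ 2 / (4 * xi))) / (2 * xi) `^ (3 / 2))%:C * v xi).

Definition reachable0 (R : realType) (K : scalar_field) (T L : R) :
    set (R -> R[i]) :=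
  [set W | odd_L2 K W /\
     exists v, [/\ Loo K T v, (norm_Loo T v <= L%:E)%E &
       {ae @lebesgue_measure R, forall x, W x = final_state T v x}]].

Definition closure_odd_L2 (R : realType) (K : scalar_field)
    (A : set (R -> R[i])) : set (R -> R[i]) :=
  [set W | odd_L2 K W /\
     forall e : R, 0 < e -> exists2 V, A V & (norm_L2 (fun x => (W x - V x)%R) < e%:E)%E].

Definition omega (R : realType) (W : R -> R[i]) (n : nat) : R[i] :=
  (n`!%:R / (2 * n + 1)`!%:R)%:C *
  Cintegral `]0, +oo[ (fun x => (x ^+ (2 * n + 1))%:C * W x).

(* Main.v *)
(* For fixed x > 0 the final state of a control v is the integral over (0, T) of
   v against a kernel that is bounded and continuous in xi, hence a limit in
   L^1(0, T) of polynomials.  The controls v_N are bounded by L and their moments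
   stabilise, so the final states F_N converge pointwise; all are dominated by a
   multiple of exp (- x^2 / (8 T)).  By Fubini the odd moments of the limit are
   those of W.  A function integrable on (0, oo) against exp (c x^2) is determined
   by its odd moments: these give the integrals against x exp (- m c x^2 / 2) for
   all naturals m, hence, approximating an indicator by Bernstein polynomials in
   exp (- c x^2 / 2), all the integrals over (0, b].  So F_N converges to W almost
   everywhere, and in L^2 by dominated convergence.

   Bernstein polynomials of a bounded function converge at its continuity points,
   with the same bound; together with dominated convergence this replaces uniform
   approximation throughout. *)
Require Import Defs.
From mathcomp Require Import all_boot all_order all_algebra.
From mathcomp Require Import all_classical all_reals all_analysis.
From mathcomp Require Import measurable_realfun ess_sup_inf.
From mathcomp Require Import complex.
From mathcomp Require Import ring lra.
Set Implicit Arguments.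
Unset Strict Implicit.
Unset Printing Implicit Defensive.
Import Order.TTheory GRing.Theory Num.Theory.
Import numFieldNormedType.Exports.
Import Normc.
Local Open Scope classical_set_scope.
Local Open Scope ring_scope.
Local Open Scope complex_scope.

(** The Gaussian rates fit together as follows. In the kernel at time xi the exponent is x^2 / (4
    xi). Half of it pays for the singular factor xi^(-3/2); the other half, as xi < T, leaves exp (-
    x^2 / (8 T)). Determinacy is applied to the difference of W and the limit V of the final states,
    with c = 1 / (16 T): this is half the decay rate of V, so exp (c x^2) V is still integrable, and
    it is the rate 1 / (4 T') of the weighted bound on W at T' = 4 T.

    The factor n! / (2n+1)! in [omega] inverts the odd moments of the kernel, which are (2n+1)! / n!
    times xi^n. The moment conditions on v_N therefore say that its final state and W have the same
    odd moments up to order N.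

    The analysis is carried out for real controls bounded everywhere. Real and imaginary parts of a
    control of modulus at most L are again bounded by L, and a null set is removed to turn the
    essential bound into a pointwise one. *)

(** * Bernstein polynomials *)

(* The mean of [f] over the number of successes in [n] Bernoulli trials, as a
   polynomial in the success probability; the recursion conditions on one trial. *)
Fixpoint bernoulli_mean (R : nzRingType) (n : nat) (f : nat -> R) : {poly R} :=
  if n is m.+1 then
    'X * bernoulli_mean m (f \o S) + (1 - 'X) * bernoulli_mean m f
  else (f 0%N)%:P.

Lemma bernoulli_mean_hornerS (R : comNzRingType) n (f : nat -> R) (x : R) :
  (bernoulli_mean n.+1 f).[x] =
  x * (bernoulli_mean n (f \o S)).[x] + (1 - x) * (bernoulli_mean n f).[x].
Proof. by rewrite /= !hornerE. Qed.

(** For x in [0, 1] each step of the recursion is a convex combination, which preserves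
    inequalities. *)
Lemma bernoulli_mean_le (R : realDomainType) n (f g : nat -> R) (x : R) :
  0 <= x <= 1 -> (forall k, (k <= n)%N -> f k <= g k) ->
  (bernoulli_mean n f).[x] <= (bernoulli_mean n g).[x].
Proof.
move=> /andP[x0 x1]; elim: n f g => [|n IH] f g fg; first by rewrite /= !hornerE fg.
rewrite !bernoulli_mean_hornerS lerD ?ler_wpM2l ?subr_ge0 ?IH// => k kn; apply: fg.
  exact: kn.
exact: leqW.
Qed.

Lemma bernoulli_mean_affine (R : comNzRingType) n (a b : R) (f : nat -> R) (x : R) :
  (bernoulli_mean n (fun k => a + b * f k)).[x] = a + b * (bernoulli_mean n f).[x].
Proof.
elim: n f => [|n IH] f; first by rewrite /= !hornerE.
rewrite !bernoulli_mean_hornerS.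
have -> : (fun k => a + b * f k) \o S = (fun k => a + b * (f \o S) k) by [].
by rewrite !IH; ring.
Qed.

(** Variance plus squared bias of the binomial law. The centre is arbitrary because conditioning on
    a success shifts it from c to c - 1, so the induction must range over all centres. *)
Lemma bernoulli_mean_sqr (R : comNzRingType) n (c : R) (x : R) :
  (bernoulli_mean n (fun k => (k%:R - c) ^+ 2)).[x] =
  n%:R * x * (1 - x) + (n%:R * x - c) ^+ 2.
Proof.
elim: n c => [|n IH] c; first by rewrite /= !hornerE.
rewrite bernoulli_mean_hornerS.
have -> : (fun k => (k%:R - c) ^+ 2) \o S = (fun k => (k%:R - (c - 1)) ^+ 2).
  by apply/funext => k /=; rewrite -natr1; ring.
by rewrite !IH -natr1; ring.
Qed.

Definition bernstein (R : realType) (f : R -> R) (n : nat) : {poly R} :=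
  bernoulli_mean n (fun k => f (k%:R / n%:R)).

Lemma bernstein_bounded (R : realType) (f : R -> R) (M : R) n (x : R) :
  (forall y, `|f y| <= M) -> 0 <= x <= 1 -> `|(bernstein f n).[x]| <= M.
Proof.
move=> fM x01.
have cstE a : (bernoulli_mean n (fun=> a)).[x] = a.
  have := @bernoulli_mean_affine R n a 0 (fun=> 0) x.
  by rewrite mulr0 addr0 mul0r addr0.
rewrite ler_norml; apply/andP; split.
  rewrite -[leLHS](cstE (- M)); apply: bernoulli_mean_le => // k _.
  by have := fM (k%:R / n%:R); rewrite ler_norml => /andP[].
rewrite -[leRHS](cstE M); apply: bernoulli_mean_le => // k _.
by have := fM (k%:R / n%:R); rewrite ler_norml => /andP[].
Qed.

(** Chebyshev's argument: continuity at x and the bound M give a quadratic majorant of the error at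
    the nodes k / n, and the mean of the quadratic part is of order 1 / n by the variance
    formula. *)
Lemma bernstein_cvg (R : realType) (f : R -> R) (M x : R) :
  (forall y, `|f y| <= M) -> 0 <= x <= 1 -> {for x, continuous f} ->
  (bernstein f n).[x] @[n --> \oo] --> f x.
Proof.
move=> fM x01 cf; apply/cvgrPdist_le => e e0.
have M0 : 0 <= M by rewrite (le_trans _ (fM 0)).
have e20 : 0 < e / 2 by rewrite divr_gt0.
move/cvgrPdist_le : cf => /(_ _ e20)[d /= d0 Hd].
near=> n.
have n0 : 0 < n%:R :> R by rewrite ltr0n; near: n; exists 1%N.
(* Nodes at distance at least d from x have error at most 2 M, and this C makes C (k / n - x)^2 at
   least 2 M there. *)
pose C := 2 * M / d ^+ 2.
have C0 : 0 <= C by rewrite divr_ge0 ?exprn_ge0 ?mulr_ge0// ltW.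
pose q k := (k%:R - n%:R * x) ^+ 2 : R.
have key k : `|f x - f (k%:R / n%:R)| <= e / 2 + C / n%:R ^+ 2 * q k.
  have qE : C / n%:R ^+ 2 * q k = C * (k%:R / n%:R - x) ^+ 2.
    by rewrite /q; field; rewrite gt_eqF.
  rewrite qE; have [xd|dx] := ltP `|x - k%:R / n%:R| d.
    by rewrite (le_trans (Hd _ xd))// lerDl mulr_ge0// sqr_ge0.
  apply: (@le_trans _ _ (2 * M)).
    by have := fM x; have := fM (k%:R / n%:R); rewrite !ler_norml; lra.
  rewrite -[leLHS]add0r lerD//; first exact: ltW.
  rewrite /C mulrAC ler_pdivlMr ?exprn_gt0// ler_wpM2l ?mulr_ge0//.
  by rewrite -[leRHS]real_normK ?num_real// distrC ler_pXn2r// ?nnegrE// ltW.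
have var : (bernoulli_mean n q).[x] <= n%:R.
  rewrite bernoulli_mean_sqr subrr expr0n addr0 -mulrA ler_piMr ?ler0n//.
  by case/andP: x01 => *; rewrite mulr_ile1 ?subr_ge0// gerBl.
have bnd : e / 2 + C / n%:R ^+ 2 * (bernoulli_mean n q).[x] <= e.
  apply: (@le_trans _ _ (e / 2 + C / n%:R ^+ 2 * n%:R)).
    by rewrite lerD2l ler_wpM2l// divr_ge0 ?exprn_ge0.
  have -> : C / n%:R ^+ 2 * n%:R = C / n%:R by field; rewrite gt_eqF.
  rewrite [leRHS](splitr e) lerD2l ler_pdivrMr// mulrC -ler_pdivrMr//.
  by near: n; exact: nbhs_infty_ger.
set S := e / 2 + _ in bnd.
have up : (bernstein f n).[x] <= f x + S.
  rewrite /S addrA -bernoulli_mean_affine; apply: bernoulli_mean_le => // k _.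
  by have := key k; rewrite ler_norml => /andP[+ _]; rewrite /q; lra.
have lo : f x - S <= (bernstein f n).[x].
  have -> : f x - S =
      (f x - e / 2) + (- (C / n%:R ^+ 2)) * (bernoulli_mean n q).[x].
    by rewrite /S; ring.
  rewrite -bernoulli_mean_affine; apply: bernoulli_mean_le => // k _.
  by have := key k; rewrite ler_norml => /andP[_]; lra.
by rewrite ler_norml; apply/andP; split; lra.
Unshelve. all: by end_near. Qed.

(** * Determinacy of odd moments under a Gaussian weight *)

Lemma dominated_integrable_real d (T : measurableType d) (R : realType)
    (mu : {measure set T -> \bar R}) (D : set T) (f g : T -> R) :
  measurable D -> measurable_fun D f -> (forall x, D x -> `|f x| <= g x) ->
  mu.-integrable D (EFin \o g) -> mu.-integrable D (EFin \o f).
Proof.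
move=> mD mf fg ig; apply: (le_integrable mD _ _ ig).
  exact/measurable_EFinP.
by move=> x Dx; rewrite /= lee_fin (le_trans (fg _ Dx))// ler_norm.
Qed.

Lemma Rintegral_dominated_cvg d (T : measurableType d) (R : realType)
    (mu : {measure set T -> \bar R}) (D : set T) (f_ : nat -> T -> R)
    (f g : T -> R) :
  measurable D -> (forall n, measurable_fun D (f_ n)) -> measurable_fun D f ->
  {ae mu, forall x, D x -> f_ n x @[n --> \oo] --> f x} ->
  mu.-integrable D (EFin \o g) -> (forall n x, D x -> `|f_ n x| <= g x) ->
  \int[mu]_(x in D) f_ n x @[n --> \oo] --> \int[mu]_(x in D) f x.
Proof.
move=> mD mf_ mf f_f ig f_g.
have [] := @dominated_convergence d T R mu D mD (fun n => EFin \o f_ n)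
  (EFin \o f) (EFin \o g).
- by move=> n; exact/measurable_EFinP.
- exact/measurable_EFinP.
- by apply: filterS f_f => x h Dx /=; apply: cvg_EFin (h Dx); exact: nearW.
- exact: ig.
- by apply: nearW => x n Dx /=; rewrite lee_fin f_g.
move=> intf _ cv; rewrite /Rintegral; apply: fine_cvg.
by rewrite fineK//; exact: integrable_fin_num.
Qed.

Lemma Rintegral_sum d (T : measurableType d) (R : realType)
    (mu : {measure set T -> \bar R}) (D : set T) (F : nat -> T -> R) n :
  measurable D -> (forall k, mu.-integrable D (EFin \o F k)) ->
  \int[mu]_(x in D) (\sum_(0 <= k < n) F k x) =
  \sum_(0 <= k < n) \int[mu]_(x in D) F k x.
Proof.
move=> mD iF; elim: n => [|n IH].
  rewrite big_nil; under eq_Rintegral do rewrite big_nil.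
  by rewrite Rintegral_cst// mul0r.
under eq_Rintegral do rewrite big_nat_recr//=.
rewrite RintegralD// ?IH ?big_nat_recr//.
rewrite (_ : EFin \o _ = fun x => (\sum_(0 <= k < n) (EFin \o F k) x)%E).
  exact: integrable_sum.
by apply/funext => x /=; rewrite sumEFin.
Qed.

(** With t = |x|^n one has t <= 1 + t^2, and t^2 = (x^2)^n is bounded through the single term (e
    x^2)^n / n! of the exponential series. Squaring avoids a distinction by the parity of n. *)
Lemma norm_exp_le_gauss (R : realType) (e : R) n : 0 < e ->
  exists2 C : R, 0 <= C & forall x, `|x| ^+ n <= C * expR (e * x ^+ 2).
Proof.
move=> e0; exists (1 + n`!%:R / e ^+ n).
  by rewrite addr_ge0// divr_ge0// exprn_ge0// ltW.
move=> x; have ex0 : 0 <= e * x ^+ 2 by rewrite mulr_ge0 ?sqr_ge0 ?ltW.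
rewrite mulrDl mul1r; apply: (@le_trans _ _ (1 + (`|x| ^+ n) ^+ 2)).
  have : 0 <= (`|x| ^+ n - 1) ^+ 2 by rewrite sqr_ge0.
  have : 0 <= `|x| ^+ n by rewrite exprn_ge0.
  by nra.
rewrite lerD//; first by rewrite (le_trans _ (expR_ge1Dx _))// lerDl.
rewrite -exprM mulnC exprM real_normK ?num_real//.
rewrite -mulrA mulrC -mulrA ler_pdivlMl ?exprn_gt0// -exprMn.
case: n => [|n]; first by rewrite expr0 fact0 mulr1 (le_trans _ (expR_ge1Dx _))// lerDl.
rewrite -ler_pdivrMr ?ltr0n ?fact_gt0//.
by apply: le_trans (expR_ge1Dxn n ex0); rewrite lerDr.
Qed.

Section determinacy.
Variables (R : realType) (h : R -> R) (c : R).
Notation mu := (@lebesgue_measure R).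
Local Notation D := `]0%R, +oo[%classic.
Hypothesis c_gt0 : 0 < c.
Hypothesis mh : measurable_fun setT h.
Hypothesis ih : mu.-integrable D (EFin \o (fun x => expR (c * x ^+ 2) * h x)).
Hypothesis moments0 : forall n, \int[mu]_(x in D) (x ^+ (2 * n + 1) * h x) = 0.

Let a := c / 2.
Let a_gt0 : 0 < a. Proof. by rewrite divr_gt0. Qed.

Let dominated_gauss (k : R -> R) C : measurable_fun setT k ->
  (forall x, D x -> `|k x| <= C * expR (c * x ^+ 2)) ->
  mu.-integrable D (EFin \o (fun x => k x * h x)).
Proof.
move=> mk kC; apply: (@dominated_integrable_real _ _ _ mu D _
  (fun x => C * `|expR (c * x ^+ 2) * h x|)) => //.
- by apply: measurable_funTS; exact: measurable_funM.
- move=> x Dx; rewrite !normrM mulrA ler_wpM2r// (le_trans (kC _ Dx))//.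
  by rewrite (ger0_norm (expR_ge0 _)).
- by have /integrable_norm/(integrableZl _ C) := ih; apply.
Qed.

Let damped_integrand m n x := expR (- (m%:R * a * x ^+ 2)) * x ^+ (2 * n + 1).

Let measurable_damped m n : measurable_fun setT (damped_integrand m n).
Proof.
apply: measurable_funM; last exact: measurable_funX.
apply: measurableT_comp => //; apply: measurableT_comp => //.
by apply: measurable_funM => //; exact: measurable_funX.
Qed.

Let damped_le m n : exists C : R, forall x,
  `|damped_integrand m n x| <= C * expR (a * x ^+ 2).
Proof.
have [C C0 HC] := norm_exp_le_gauss (2 * n + 1) a_gt0; exists C => x.
rewrite normrM normrX (le_trans _ (HC x))// ger0_norm ?expR_ge0//.
rewrite ler_piMl ?exprn_ge0// expR_le1 oppr_le0.
by rewrite mulr_ge0 ?sqr_ge0// mulr_ge0// ltW.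
Qed.

Let expRa_le_c x : expR (a * x ^+ 2) <= expR (c * x ^+ 2).
Proof.
by rewrite ler_expR ler_wpM2r ?sqr_ge0// /a ler_pdivrMr// mulr_natr mulr2n lerDl ltW.
Qed.

Let integrable_damped m n :
  mu.-integrable D (EFin \o (fun x => damped_integrand m n x * h x)).
Proof.
have [C HC] := damped_le m n; apply: (dominated_gauss (C := C)) => // x _.
have C0 : 0 <= C.
  by have := le_trans (normr_ge0 _) (HC 0); rewrite expr0n mulr0 expR0 mulr1.
by rewrite (le_trans (HC x))// ler_wpM2l.
Qed.

(* One factor exp (- a x^2) is expanded into its series, i.e. into higher odd
   moments; its partial sums are dominated by exp (a x^2), and a = c / 2 leaves
   exp (a x^2) of the weight to absorb the power of x. *)
Let damped_moments0 m n : \int[mu]_(x in D) (damped_integrand m n x * h x) = 0.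
Proof.
elim: m n => [|m IH] n.
  rewrite -[RHS](moments0 n); apply: eq_Rintegral => x _.
  by rewrite /damped_integrand !mul0r oppr0 expR0 mul1r.
pose F k x := (- a) ^+ k / k`!%:R * (damped_integrand m (n + k) x * h x).
pose f_ j x := \sum_(0 <= k < j) F k x.
have FE k x : F k x =
    exp_coeff (- (a * x ^+ 2)) k * (damped_integrand m n x * h x).
  have expE z : exp_coeff z k = z ^+ k / k`!%:R :> R by [].
  have sqE : (- (a * x ^+ 2)) ^+ k = (- a) ^+ k * x ^+ (2 * k).
    by rewrite exprM -exprMn mulNr.
  rewrite /F expE sqE /damped_integrand.
  rewrite [in LHS]mulnDr addnAC exprD; ring.
have fE j x : f_ j x =
    series (exp_coeff (- (a * x ^+ 2))) j * (damped_integrand m n x * h x).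
  rewrite /f_ /series /= mulr_suml; apply: eq_bigr => k _; exact: FE.
have iF k : mu.-integrable D (EFin \o F k).
  by have /(integrableZl _ ((- a) ^+ k / k`!%:R)) := integrable_damped m (n + k); apply.
have f0 j : \int[mu]_(x in D) f_ j x = 0.
  rewrite Rintegral_sum// big1// => k _; rewrite RintegralZl// ?IH ?mulr0//.
have [C HC] := damped_le m n.
have : \int[mu]_(x in D) f_ j x @[j --> \oo] -->
    \int[mu]_(x in D) (damped_integrand m.+1 n x * h x).
  apply: (@Rintegral_dominated_cvg _ _ _ mu D f_ _
    (fun x => C * `|expR (c * x ^+ 2) * h x|)) => //.
  - move=> j; apply: measurable_funTS.
    apply: measurable_sum => k; rewrite /F.
    apply: (measurable_funM (measurable_cst _)).
    exact: (measurable_funM (measurable_damped _ _) mh).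
  - by apply: measurable_funTS; exact: (measurable_funM (measurable_damped _ _) mh).
  - apply: nearW => x _.
    have -> : damped_integrand m.+1 n x * h x =
        expR (- (a * x ^+ 2)) * (damped_integrand m n x * h x).
      rewrite /damped_integrand -[m.+1%:R]natr1 mulrDl mul1r mulrDl opprD addrC.
      by rewrite expRD [RHS]mulrA; congr (_ * _); rewrite [RHS]mulrA.
    rewrite (_ : f_ ^~ x = fun j =>
      series (exp_coeff (- (a * x ^+ 2))) j * (damped_integrand m n x * h x)).
      exact: (cvgM (is_cvg_series_exp_coeff _) (cvg_cst _)).
    by apply/funext => j; exact: fE.
  - by have /integrable_norm/(integrableZl _ C) := ih; apply.
  - move=> j x _; rewrite fE normrM [`|damped_integrand m n x * h x|]normrM.
    rewrite [`|expR _ * h x|]normrM mulrA [leRHS]mulrA ler_wpM2r//.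
    rewrite (ger0_norm (expR_ge0 _)) mulrC.
    have S : `|series (exp_coeff (- (a * x ^+ 2))) j| <= expR (a * x ^+ 2).
      have a0 : 0 <= a * x ^+ 2 by rewrite mulr_ge0 ?sqr_ge0 ?ltW.
      apply: (@le_trans _ _ (series (exp_coeff (a * x ^+ 2)) j)).
        rewrite /series /= (le_trans (ler_norm_sum _ _ _))// ler_sum// => k _.
        by rewrite normrM normrX normrN (ger0_norm a0) ger0_norm// invr_ge0.
      apply: nondecreasing_cvgn_le; last exact: is_cvg_series_exp_coeff.
      apply/nondecreasing_seqP => k; rewrite /series /= big_nat_recr//= lerDl.
      exact: exp_coeff_ge0.
    apply: (le_trans (ler_pM _ _ (HC x) S)) => //.
    rewrite -mulrA -expRD; have -> : a * x ^+ 2 + a * x ^+ 2 = c * x ^+ 2.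
      by rewrite /a; field.
    by [].
under eq_cvg do rewrite f0.
by move=> /(cvg_lim (@Rhausdorff R)) <-; rewrite lim_cst.
Qed.

Let y x := expR (- (a * x ^+ 2)).

Let y01 x : 0 <= y x <= 1.
Proof.
by rewrite expR_ge0 expR_le1 oppr_le0 mulr_ge0 ?sqr_ge0// ltW.
Qed.

Let poly_moments0 (p : {poly R}) : \int[mu]_(x in D) (p.[y x] * (x * h x)) = 0.
Proof.
pose F k x := p`_k * (damped_integrand k 0 x * h x).
have FE x : p.[y x] * (x * h x) = \sum_(0 <= k < size p) F k x.
  rewrite horner_coef mulr_suml big_mkord; apply: eq_bigr => k _.
  rewrite /F /damped_integrand /y -expRM_natl muln0 add0n expr1 -!mulrA.
  by rewrite mulrN !mulrA.
under eq_Rintegral do rewrite FE.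
rewrite Rintegral_sum//; last first.
  by move=> k; have /(integrableZl _ p`_k) := integrable_damped k 0; apply.
by rewrite big1// => k _; rewrite RintegralZl// damped_moments0 mulr0.
Qed.

Let measurable_y : measurable_fun setT y.
Proof.
apply: measurableT_comp => //; apply: measurableT_comp => //.
by apply: measurable_funM => //; exact: measurable_funX.
Qed.

Let integrable_xh : mu.-integrable D (EFin \o (fun x => x * h x)).
Proof.
have [C C0 HC] := norm_exp_le_gauss 1 c_gt0.
apply: (dominated_gauss (C := C)) => //.
by move=> x _; have := HC x; rewrite expr1.
Qed.

(** Since [y] is strictly decreasing on the half-line, the indicator of (0, b] is a step function of
    y x. Its only jump is at y b, reached only at x = b, so its Bernstein polynomials converge off a
    single point; the integral of each of them vanishes. *)
Let initial_integral0 b : 0 < b ->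
  \int[mu]_(x in D) ((x <= b)%R%:R * (x * h x)) = 0.
Proof.
move=> b0; pose phi t : R := (y b <= t)%R%:R.
have phi1 t : `|phi t| <= 1 by rewrite /phi normr_nat lern1 leq_b1.
have y_lt x x' : 0 < x -> x < x' -> y x' < y x.
  move=> x0 xx'; rewrite ltr_expR ltrN2 ltr_pM2l// ltr_pXn2r// nnegrE ltW//.
  exact: lt_trans xx'.
have phiE x : D x -> (x <= b)%R%:R = phi (y x).
  rewrite /= in_itv/= andbT /phi => x0.
  have [xb|bx|->] := ltgtP x b; last by rewrite lexx.
    by rewrite ltW// y_lt.
  by rewrite leNgt y_lt.
transitivity (\int[mu]_(x in D) (phi (y x) * (x * h x))).
  by apply: eq_Rintegral => x /[!inE] Dx; rewrite phiE.
have mphi : measurable_fun setT phi.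
  apply: measurableT_comp => //; apply: measurable_fun_ler => //.
have cv x : 0 < x -> x <> b -> (bernstein phi n).[y x] @[n --> \oo] --> phi (y x).
  move=> x0 /eqP xb; apply: (bernstein_cvg phi1) => //.
  move: xb; rewrite neq_lt => /orP[/(y_lt _ _ x0) yx|/(y_lt _ _ b0) yx].
    have H : \forall t \near y x, y b < t by exact: lt_nbhsr.
    rewrite /continuous_at; apply: cvg_near_cst; apply: filterS H => t yt.
    by rewrite /phi !ltW.
  have H : \forall t \near y x, t < y b by exact: lt_nbhsl.
  rewrite /continuous_at; apply: cvg_near_cst; apply: filterS H => t yt.
  by rewrite /phi !leNgt yx yt.
have : \int[mu]_(x in D) ((bernstein phi n).[y x] * (x * h x)) @[n --> \oo] -->
    \int[mu]_(x in D) (phi (y x) * (x * h x)).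
  apply: (@Rintegral_dominated_cvg _ _ _ mu D _ _ (fun x => `|x * h x|)) => //.
  - move=> n; apply: measurable_funTS; apply: measurable_funM; last exact: measurable_funM.
    apply: measurableT_comp measurable_y => //.
    by apply: continuous_measurable_fun; exact: continuous_horner.
  - apply: measurable_funTS; apply: measurable_funM; last exact: measurable_funM.
    exact: measurableT_comp.
  - exists [set b]; split => //; first exact: lebesgue_measure_set1.
    move=> x /= /not_implyP[]; rewrite in_itv/= andbT => x0.
    apply: contra_notP => xb; have cvx := cv x x0 xb.
    exact: (cvgM cvx (cvg_cst _)).
  - exact: integrable_norm.
  - move=> n x _; rewrite normrM ler_piMl// (bernstein_bounded _ phi1)//.
under eq_cvg do rewrite poly_moments0.
by move=> /(cvg_lim (@Rhausdorff R)) <-; rewrite lim_cst.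
Qed.

(** All primitives of x h x vanish, so Lebesgue differentiation makes x h x zero almost everywhere,
    and x is positive. *)
Lemma gauss_moments_determinate : {ae mu, forall x, 0 < x -> h x = 0}.
Proof.
(* Extension by zero allows primitives taken from minus infinity, which vanish also at endpoints b
   <= 0. *)
pose f := (fun x => x * h x) \_ D.
have intf : mu.-integrable setT (EFin \o f).
  by move: integrable_xh; rewrite integrable_mkcond//= restrict_EFin.
have F0 b : \int[mu]_(t in `]-oo, b]) f t = 0.
  rewrite -Rintegral_mkcondr; have [b0|b0] := leP b 0.
    rewrite (_ : _ `&` _ = set0) ?Rintegral_set0//.
    apply/seteqP; split => // x /=; rewrite !in_itv/= andbT => -[xb x0].
    by have := lt_le_trans x0 (le_trans xb b0); rewrite ltxx.
  rewrite setIC Rintegral_mkcondr -[RHS](initial_integral0 b0).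
  apply: eq_Rintegral => x _; rewrite patchE.
  have -> : (x \in `]-oo, b]%classic) = (x <= b).
    by apply/idP/idP; rewrite inE/= in_itv/=.
  by case: ifP => _; rewrite ?mul1r ?mul0r.
have intfb b : mu.-integrable `]-oo, b] (EFin \o f) by apply: integrableS intf.
have := FTC1Ny intfb (open_integrable_locally openT intf).
apply: filterS; first exact: (ae_filter_ringOfSetsType mu).
move=> x /= [_ +] x0.
have -> : (fun x0 : R => \int[mu]_(t in `]-oo, x0]) f t) = cst 0.
  by apply/funext => b; exact: F0.
rewrite derive1_cst /f patchE mem_set/=; last by rewrite in_itv/= x0.
by move=> /esym/eqP; rewrite mulf_eq0 gt_eqF//= => /eqP.
Qed.

End determinacy.

(** * Gaussian moments *)

Section gauss_moments.
Variable R : realType.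
Notation mu := (@lebesgue_measure R).
Implicit Types (x s a xi : R) (m n : nat).

(** Both facts are read off the normal density, which is integrable with total mass 1, by dividing
    out its peak value. *)
Lemma integral_gauss_normal s : 0 < s ->
  (\int[mu]_x (expR (- (x ^+ 2 / (s ^+ 2 *+ 2))))%:E =
    (Num.sqrt (s ^+ 2 * pi *+ 2))%:E)%E /\
  mu.-integrable setT (EFin \o (fun x => expR (- (x ^+ 2 / (s ^+ 2 *+ 2))))).
Proof.
move=> s0; have sn0 : s != 0 by rewrite gt_eqF.
have p0 := normal_peak_gt0 sn0.
have pdfE x : expR (- (x ^+ 2 / (s ^+ 2 *+ 2))) =
    (normal_peak s)^-1 * normal_pdf 0 s x.
  rewrite normal_pdfE// /normal_fun subr0 mulNr mulrA mulVf ?mul1r// gt_eqF//.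
have ip := @integrable_normal_pdf R 0 s.
split.
  under eq_integral do rewrite pdfE EFinM.
  by rewrite integralZl// integral_normal_pdf mule1 /normal_peak invrK.
rewrite (_ : EFin \o _ = fun x => ((normal_peak s)^-1%:E * (normal_pdf 0 s x)%:E)%E).
  exact: integrableZl.
by apply/funext => x /=; rewrite pdfE EFinM.
Qed.

Lemma integrable_gauss a : 0 < a ->
  mu.-integrable setT (EFin \o (fun x => expR (- (a * x ^+ 2)))).
Proof.
(* This standard deviation solves 2 s^2 = 1 / a. *)
move=> a0; have s0 : 0 < Num.sqrt (2 * a)^-1 by rewrite sqrtr_gt0 invr_gt0 mulr_gt0.
have [_] := integral_gauss_normal s0; congr (_.-integrable _ _).
apply/funext => x /=; congr (expR (- _))%:E.
rewrite sqr_sqrtr ?invr_ge0 ?mulr_ge0 ?ltW// mulrC; congr (_ * _).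
by field; rewrite gt_eqF.
Qed.

Lemma measurable_gaussM a m :
  measurable_fun setT (fun x => x ^+ m * expR (- (a * x ^+ 2))).
Proof.
apply: measurable_funM; first exact: measurable_funX.
apply: measurableT_comp => //; apply: measurableT_comp => //.
by apply: measurable_funM => //; exact: measurable_funX.
Qed.

Lemma integrable_gaussM a m : 0 < a ->
  mu.-integrable setT (EFin \o (fun x => x ^+ m * expR (- (a * x ^+ 2)))).
Proof.
move=> a0; have a20 : 0 < a / 2 by rewrite divr_gt0.
have [C C0 HC] := norm_exp_le_gauss m a20.
apply: (@dominated_integrable_real _ _ _ mu _ _
  (fun x => C * expR (- (a / 2 * x ^+ 2)))) => //.
- exact: measurable_gaussM.
- move=> x _; rewrite normrM normrX (ger0_norm (expR_ge0 _)).
  apply: le_trans (ler_wpM2r (expR_ge0 _) (HC x)) _.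
  rewrite -[leLHS]mulrA -expRD; have -> : a / 2 * x ^+ 2 - a * x ^+ 2 = - (a / 2 * x ^+ 2).
    by field.
  by [].
- by have /(integrableZl _ C) := integrable_gauss a20; apply.
Qed.

Local Notation D := `]0%R, +oo[%classic.

Definition gauss_moment xi m := \int[mu]_(x in D) (x ^+ m * expR (- (x ^+ 2 / (4 * xi)))).

Lemma gauss_moment0 xi : 0 < xi -> gauss_moment xi 0 = Num.sqrt (pi * xi).
Proof.
(* With s^2 = 2 xi the exponent x^2 / (2 s^2) is x^2 / (4 xi); evenness then halves the integral
   over the line. *)
move=> xi0; have s0 : 0 < Num.sqrt (2 * xi) by rewrite sqrtr_gt0 mulr_gt0.
have [] := integral_gauss_normal s0.
rewrite sqr_sqrtr ?mulr_ge0 ?ltW// => + ig.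
have E4 : (2 * xi) *+ 2 = 4 * xi by rewrite -mulr_natr; ring.
rewrite (_ : 2 * xi * pi *+ 2 = 4 * (pi * xi)); last by rewrite -mulr_natr; ring.
rewrite sqrtrM// (_ : 4 = 2 ^+ 2) ?sqrtr_sqr ?ger0_norm//; last by rewrite expr2; ring.
rewrite E4.
rewrite ge0_symfun_integralT; last 3 first.
- by move=> x; exact: expR_ge0.
- move=> x; apply: continuous_comp; last exact: continuous_expR.
  apply: continuousN; apply: continuousM; last exact: cvg_cst.
  exact: exprn_continuous.
- by move=> x /=; rewrite sqrrN.
rewrite -set_itvcy -integral_itv_obnd_cbnd; last first.
  apply/measurable_EFinP; apply: measurable_funTS.
  apply: measurableT_comp => //; apply: measurableT_comp => //.
  by apply: measurable_funM => //; exact: measurable_funX.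
rewrite /gauss_moment /Rintegral; under [in X in fine X]eq_integral do rewrite expr0 mul1r.
set I := (\int[_]_(x in _) _)%E => HI.
have : (I = (Num.sqrt (pi * xi))%:E)%E.
  move: HI; case: I => [r| |]//=.
  - by rewrite -EFinM => -[] /(mulfI _) ->//; rewrite pnatr_eq0.
  - by rewrite mulry gtr0_sg// mul1e.
  - by rewrite mulrNy gtr0_sg// mul1e.
by move=> ->.
Qed.

(** Integration by parts: x^(n+1) exp (- x^2 / (4 xi)) vanishes at 0 and at infinity, so its
    derivative, a combination of the two integrands, has integral zero. The fundamental theorem is
    applied on (0, k + 1] and k is sent to infinity. *)
Lemma gauss_momentSS xi n : 0 < xi ->
  gauss_moment xi n.+2 = 2 * xi * n.+1%:R * gauss_moment xi n.
Proof.
move=> xi0; pose b := (4 * xi)^-1.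
have b0 : 0 < b by rewrite invr_gt0 mulr_gt0.
have bE x : x ^+ 2 / (4 * xi) = b * x ^+ 2 by rewrite mulrC.
pose g m x := x ^+ m * expR (- (b * x ^+ 2)).
have momE m : gauss_moment xi m = \int[mu]_(x in D) g m x.
  by apply: eq_Rintegral => x _; rewrite bE.
have ig m : mu.-integrable D (EFin \o g m).
  by apply: integrableS (integrable_gaussM m b0).
pose F x := g n.+1 x.
pose f x := n.+1%:R * g n x - 2 * b * g n.+2 x.
have dF x : is_derive x 1 F (f x).
  rewrite /F /g.
  have -> : f x = x ^+ n.+1 * (expR (- (b * x ^+ 2)) * (- (b * (2 * x)))) +
      (n.+1%:R * x ^+ n) * expR (- (b * x ^+ 2)).
    by rewrite /f /g !exprS; ring.
  have d1 : is_derive x 1 (fun y => - (b * y ^+ 2)) (- (b * (2 * x))).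
    by apply: is_derive_eq; rewrite /GRing.scale/=; ring.
  have d2 := is_derive1_comp (is_derive_expR _) d1.
  have d3 : is_derive x 1 (fun y => y ^+ n.+1) (n.+1%:R * x ^+ n).
    have := is_deriveX n.+1 (is_derive_id x (1 : R)).
    by rewrite exprfctE /GRing.scale/= mulr1.
  apply: (is_derive_eq (is_deriveM d3 d2)).
  by rewrite /GRing.scale/=; congr (_ + _); rewrite mulrC.
have cg m : continuous (g m).
  move=> x.
  apply: (@continuousM R R (fun x => x ^+ m) (fun x => expR (- (b * x ^+ 2))));
    first exact: exprn_continuous.
  apply: continuous_comp; last exact: continuous_expR.
  apply: continuousN; apply: continuousM; first exact: cvg_cst.
  exact: exprn_continuous.
have cf : continuous f.
  move=> x; apply: (@continuousB R R R (fun x => n.+1%:R * g n x)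
    (fun x => 2 * b * g n.+2 x)).
    by apply: (@continuousM R R (cst n.+1%:R)); [exact: cvg_cst|exact: cg].
  by apply: (@continuousM R R (cst (2 * b))); [exact: cvg_cst|exact: cg].
have FTC k : \int[mu]_(x in D) (f \_ `]0, k.+1%:R]) x = F k.+1%:R.
  rewrite -Rintegral_mkcondr.
  have -> : D `&` `]0, k.+1%:R] = `]0, (k.+1%:R : R)]%classic.
    by apply/seteqP; split => x /=; rewrite !in_itv/= ?andbT; [case|move=> /andP[-> ->]].
  have icc : mu.-integrable `[0, k.+1%:R] (EFin \o f).
    apply: continuous_compact_integrable; first exact: segment_compact.
    exact: continuous_subspaceT.
  rewrite Rintegral_itv_obnd_cbnd; last first.
    by apply: integrableS icc => //; exact: subset_itv_oc_cc.
  rewrite /Rintegral (@continuous_FTC2 R f F)//.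
  - by rewrite [F 0]/F /g expr0n mul0r sube0.
  - exact: continuous_subspaceT.
  - split; first by move=> x _; exact: ex_derive.
      by apply: cvg_at_right_filter; exact: cg.
    by apply: cvg_at_left_filter; exact: cg.
  - by move=> x _; rewrite derive1E; exact: derive_val.
have i1 : mu.-integrable D (EFin \o (fun x => n.+1%:R * g n x)).
  by have /(integrableZl _ n.+1%:R) := ig n; apply.
have i2 : mu.-integrable D (EFin \o (fun x => 2 * b * g n.+2 x)).
  by have /(integrableZl _ (2 * b)) := ig n.+2; apply.
have iF : mu.-integrable D (EFin \o f).
  by apply: (integrableB _ i1 i2).
have lim1 : F k.+1%:R @[k --> \oo] --> \int[mu]_(x in D) f x.
  rewrite -(funext FTC).
  apply: (@Rintegral_dominated_cvg _ _ _ mu D _ _ (fun x => `|f x|)) => //.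
  - move=> k; apply/(measurable_restrict _ _ _) => //.
    by apply: measurable_funTS; exact: continuous_measurable_fun.
  - by apply: measurable_funTS; exact: continuous_measurable_fun.
  - apply: nearW => x; rewrite /= in_itv/= andbT => x0.
    apply: cvg_near_cst; near=> k; rewrite patchE mem_set//= in_itv/= x0/=.
    by rewrite (le_trans (ltW (archi_boundP (ltW x0))))// ler_nat leqW//; near: k; exact: nbhs_infty_ge.
  - exact: integrable_norm.
  - by move=> k x _; rewrite patchE; case: ifP; rewrite ?normr0.
(* Bounding the next power x^(n+2) by C exp (b x^2) gives 0 <= F x <= C / x, which at x = k + 1 is C
   times the harmonic sequence. *)
have lim0 : F k.+1%:R @[k --> \oo] --> 0.
  have [C C0 HC] := norm_exp_le_gauss n.+2 b0.
  have h1 : C * harmonic k @[k --> \oo] --> (0 : R).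
    by rewrite -[X in _ --> X](mulr0 C); apply: cvgM; [exact: cvg_cst|exact: cvg_harmonic].
  have h0 : (0 : R) @[k --> \oo] --> (0 : R) by exact: cvg_cst.
  apply/norm_cvg0P; apply: squeeze_cvgr h0 h1; near=> k.
  rewrite normr_ge0/= /F /g normrM (ger0_norm (expR_ge0 _)) normrX normr_nat.
  rewrite expRN ler_pdivrMr ?expR_gt0// mulrAC ler_pdivlMr ?ltr0n// mulrC.
  by have := HC k.+1%:R; rewrite normr_nat exprS.
have : \int[mu]_(x in D) f x = 0.
  rewrite -(cvg_lim (@Rhausdorff R) lim1).
  exact: (cvg_lim (@Rhausdorff R) lim0).
rewrite RintegralB// !RintegralZl// -!momE => /subr0_eq E.
have -> : gauss_moment xi n.+2 = (2 * b)^-1 * (2 * b * gauss_moment xi n.+2).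
  by rewrite mulKf// mulf_neq0 ?pnatr_eq0// gt_eqF.
by rewrite -E /b; field; rewrite gt_eqF.
Unshelve. all: by end_near. Qed.

(** The form of the right-hand side is chosen for the kernel: the factor 2 xi sqrt (pi xi) will
    cancel (2 xi)^(3/2) up to a constant and leave xi^n alone. *)
Lemma gauss_moment_even xi n : 0 < xi ->
  gauss_moment xi (2 * n + 2) =
  (2 * n + 1)`!%:R / n`!%:R * xi ^+ n * (2 * xi) * Num.sqrt (pi * xi).
Proof.
move=> xi0; elim: n => [|n IH].
  rewrite !muln0 !add0n gauss_momentSS// gauss_moment0//.
  by rewrite (_ : 1`! = 1%N)// (_ : 0`! = 1%N)// expr0; field.
have -> : (2 * n.+1 + 2 = (2 * n + 2).+2)%N by rewrite mulnS -addnA.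
have -> : (2 * n.+1 + 1 = (2 * n + 1).+2)%N by rewrite mulnS -addnA.
rewrite gauss_momentSS// IH !factS exprS !natrM.
have -> : (2 * n + 2).+1%:R = 2 * n%:R + 3 :> R.
  by rewrite -natr1 natrD natrM; ring.
have -> : (2 * n + 1).+1%:R = 2 * (n.+1%:R) :> R.
  by rewrite -!natr1 natrD natrM; ring.
have -> : (2 * n + 1).+2%:R = 2 * n%:R + 3 :> R.
  by rewrite -!natr1 natrD natrM; ring.
by field; rewrite nat1r !pnatr_eq0 -lt0n fact_gt0.
Qed.
End gauss_moments.

(** * The kernel *)

Section heat_kernel.
Variable R : realType.
Notation mu := (@lebesgue_measure R).
Implicit Types (x xi T : R).

(** Times sqrt (2 / pi), this is - 2 dG/dx for the heat kernel G = exp (- x^2 / (4 xi)) / sqrt (4 pi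
    xi), in accordance with the source term - 2 u delta'. *)
Definition heat_kernel x xi : R :=
  x * (expR (- (x ^+ 2 / (4 * xi))) / (2 * xi) `^ (3 / 2)).

Lemma powR32 (a : R) : 0 <= a -> a `^ (3 / 2) = a * Num.sqrt a.
Proof.
move=> a0; rewrite (_ : 3 / 2 = 1 + 2^-1); last by field.
rewrite powRD ?powRr1 ?powR12_sqrt//; apply/implyP.
by rewrite gt_eqF// addr_gt0.
Qed.

(* Unlike the kernel, this majorant has an elementary antiderivative in xi,
   - |x| / sqrt (x ^+ 2 + 2 * xi), whose increments are at most 1: this makes
   the bounds uniform as x tends to 0. *)
Definition heat_majorant x xi : R := `|x| / ((x ^+ 2 + 2 * xi) * Num.sqrt (x ^+ 2 + 2 * xi)).

Let heat_majorant_ge0 x xi : 0 <= xi -> 0 <= heat_majorant x xi.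
Proof.
by move=> xi0; rewrite divr_ge0// mulr_ge0// addr_ge0 ?sqr_ge0// mulr_ge0.
Qed.

(** With s = x^2 / (2 xi), the quotient of the kernel by the majorant has absolute value exp (- s /
    2) (1 + s)^(3/2). Half of the exponent, s / 4 = x^2 / (8 xi), exceeds x^2 / (8 T) or equals it.
    The other half is two factors exp (- s / 8), and 1 + s <= 8 (1 + s / 8) <= 8 exp (s / 8), whence
    the constant 64 = 8^2. *)
Lemma heat_kernel_le x xi T : 0 < xi -> xi < T ->
  `|heat_kernel x xi| <= 64 * expR (- (x ^+ 2 / (8 * T))) * heat_majorant x xi.
Proof.
move=> xi0 xiT; have T0 : 0 < T by exact: lt_trans xiT.
have xi20 : 0 < 2 * xi by rewrite mulr_gt0.
pose s := x ^+ 2 / (2 * xi).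
have s0 : 0 <= s by rewrite divr_ge0 ?sqr_ge0// ltW.
have yE : x ^+ 2 + 2 * xi = 2 * xi * (1 + s) by rewrite /s; field; rewrite gt_eqF.
set r := Num.sqrt (2 * xi).
have r0 : 0 < r by rewrite sqrtr_gt0.
have sq1 : 0 < Num.sqrt (1 + s) by rewrite sqrtr_gt0 ltr_pwDl.
have sqle : Num.sqrt (1 + s) <= 1 + s.
  have h : 1 <= Num.sqrt (1 + s) by rewrite -[leLHS]sqrtr1 ler_wsqrtr// lerDl.
  by rewrite -[leRHS]sqr_sqrtr ?addr_ge0// expr2 ler_peMr// ltW.
have e1 : expR (- (x ^+ 2 / (4 * xi))) =
    expR (- (x ^+ 2 / (8 * xi))) * expR (- (s / 8)) ^+ 2.
  by rewrite -expRM_natl -expRD; congr expR; rewrite /s; field; rewrite gt_eqF.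
have e2 : expR (- (x ^+ 2 / (8 * xi))) <= expR (- (x ^+ 2 / (8 * T))).
  rewrite ler_expR lerN2 ler_wpM2l ?sqr_ge0// lef_pV2 ?posrE ?mulr_gt0//.
  by rewrite ler_pM2l// ltW.
have e3 : expR (- (s / 8)) * (1 + s) <= 8.
  rewrite expRN mulrC ler_pdivrMr ?expR_gt0//.
  have := expR_ge1Dx (s / 8); lra.
have e4 : expR (- (s / 8)) ^+ 2 * (1 + s) ^+ 2 <= 64.
  rewrite -exprMn; have : 0 <= expR (- (s / 8)) * (1 + s).
    by rewrite mulr_ge0 ?expR_ge0 ?addr_ge0.
  by move=> h; nra.
rewrite /heat_kernel /heat_majorant powR32 ?(ltW xi20)// -/r normrM [`|_ / _|]ger0_norm; last first.
  by rewrite divr_ge0 ?expR_ge0// mulr_ge0// ltW.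
rewrite yE sqrtrM ?(ltW xi20)// -/r.
rewrite [leRHS](_ : _ = `|x| * ((64 * expR (- (x ^+ 2 / (8 * T)))) /
  (2 * xi * (1 + s) * (r * Num.sqrt (1 + s))))); last by rewrite mulrCA.
rewrite ler_wpM2l// ler_pdivlMr; last by rewrite !mulr_gt0// ltr_pwDl.
rewrite mulrAC ler_pdivrMr ?mulr_gt0//.
rewrite (_ : _ * (_ * _ * (r * _)) = (2 * xi * r) *
   (expR (- (x ^+ 2 / (4 * xi))) * ((1 + s) * Num.sqrt (1 + s)))); last by ring.
have rr : 0 <= 2 * xi * r by rewrite mulr_ge0// ltW.
rewrite [leLHS]mulrC; apply: (ler_wpM2r rr); rewrite e1 -mulrA.
rewrite [leRHS]mulrC ler_pM ?expR_ge0 ?mulr_ge0 ?exprn_ge0 ?expR_ge0 ?addr_ge0 ?(ltW sq1)//.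
apply: le_trans e4; rewrite ler_wpM2l ?exprn_ge0 ?expR_ge0// expr2 ler_wpM2l//.
by rewrite addr_ge0.
Qed.

(** A bound free of xi, for fixed x: in the denominator of the majorant the two factors are at least
    x^2 and |x|. It supplies the boundedness required for polynomial approximation in xi. *)
Lemma heat_kernel_le_inv_sqr x xi : x != 0 -> 0 < xi ->
  `|heat_kernel x xi| <= 64 / x ^+ 2.
Proof.
move=> x0 xi0; have x20 : 0 < x ^+ 2 by rewrite exprn_even_gt0.
have nx0 : 0 < `|x| by rewrite normr_gt0.
apply: le_trans (@heat_kernel_le x xi (xi + 1) xi0 _) _; first by rewrite ltrDl.
have e1 : 64 * expR (- (x ^+ 2 / (8 * (xi + 1)))) <= 64.
  by rewrite ler_piMr// expR_le1 oppr_le0 divr_ge0 ?sqr_ge0// mulr_ge0// addr_ge0// ltW.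
apply: le_trans (ler_wpM2r (heat_majorant_ge0 _ (ltW xi0)) e1) _; rewrite ler_wpM2l//.
have yx : x ^+ 2 <= x ^+ 2 + 2 * xi by rewrite lerDl mulr_ge0// ltW.
have sx : `|x| <= Num.sqrt (x ^+ 2 + 2 * xi) by rewrite -sqrtr_sqr ler_wsqrtr.
rewrite /heat_majorant ler_pdivrMr; last by rewrite mulr_gt0//; [exact: lt_le_trans yx|exact: lt_le_trans sx].
by rewrite ler_pdivlMl// ler_pM// ltW.
Qed.

Let heat_majorant_continuous x xi : x != 0 -> 0 <= xi -> {for xi, continuous (heat_majorant x)}.
Proof.
move=> x0 xi0; have y0 : 0 < x ^+ 2 + 2 * xi.
  by rewrite ltr_pwDl ?mulr_ge0// exprn_even_gt0.
have cy : {for xi, continuous (fun z : R => x ^+ 2 + 2 * z)}.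
  apply: (@continuousD R R R (cst (x ^+ 2)) (fun z => 2 * z)); first exact: cvg_cst.
  by apply: (@continuousM R R (cst 2) id); [exact: cvg_cst|exact: cvg_id].
have cs : {for xi, continuous (fun z : R => Num.sqrt (x ^+ 2 + 2 * z))}.
  by apply: (continuous_comp cy); exact: sqrt_continuous.
apply: (@continuousM R R (cst `|x|)); first exact: cvg_cst.
apply: continuousV; first by rewrite mulf_neq0// gt_eqF// sqrtr_gt0.
exact: (continuousM cy cs).
Qed.

Let heat_majorant_integral_le1 x T : x != 0 -> 0 < T ->
  (\int[mu]_(xi in `]0%R, T[) (heat_majorant x xi)%:E <= 1)%E.
Proof.
move=> x0 T0; have x20 : 0 < x ^+ 2 by rewrite exprn_even_gt0.
pose Q xi : R := - `|x| * (Num.sqrt (x ^+ 2 + 2 * xi))^-1.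
have y0 xi : 0 <= xi -> 0 < x ^+ 2 + 2 * xi by move=> xi0; rewrite ltr_pwDl// mulr_ge0.
have s0 xi : 0 <= xi -> 0 < Num.sqrt (x ^+ 2 + 2 * xi) by move=> /y0; rewrite sqrtr_gt0.
have dQ xi : 0 <= xi -> is_derive xi 1 Q (heat_majorant x xi).
  move=> xi0.
  have d1 : is_derive xi 1 (fun z => x ^+ 2 + 2 * z) 2.
    by apply: is_derive_eq; rewrite /GRing.scale/=; ring.
  have d2 := @is_derive1_comp R Num.sqrt (fun z => x ^+ 2 + 2 * z) _ _ _
    (is_derive1_sqrt (y0 _ xi0)) d1.
  have d3 := @is_deriveV R (Num.sqrt \o (fun z => x ^+ 2 + 2 * z)) _ _ _
    (lt0r_neq0 (s0 _ xi0)) d2.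
  have d4 := is_deriveZ (- `|x|) d3.
  apply: (is_derive_eq d4).
  rewrite /GRing.scale/= /heat_majorant -[X in _ = _ / (X * _)](sqr_sqrtr (ltW (y0 _ xi0))).
  by field; rewrite gt_eqF ?s0.
have cq : {within `[0, T], continuous (heat_majorant x)}.
  apply: continuous_in_subspaceT => xi; rewrite inE/= in_itv/= => /andP[xi0 _].
  exact: heat_majorant_continuous.
have cQ xi : 0 <= xi -> {for xi, continuous Q}.
  move=> xi0; apply: differentiable_continuous; apply/derivable1_diffP.
  by have [] := dQ _ xi0.
have qE : (\int[mu]_(xi in `[0%R, T]) (heat_majorant x xi)%:E = (Q T)%:E - (Q 0)%:E)%E.
  apply: continuous_FTC2 => //.
  - split.
    + by move=> z; rewrite in_itv/= => /andP[z0 _]; have [] := dQ _ (ltW z0).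
    + by apply: cvg_at_right_filter; exact: cQ.
    + by apply: cvg_at_left_filter; apply: cQ; exact: ltW.
  - move=> z; rewrite in_itv/= => /andP[z0 _]; rewrite derive1E.
    by have [_] := dQ _ (ltW z0).
apply: (@le_trans _ _ (\int[mu]_(xi in `[0%R, T]) (heat_majorant x xi)%:E)%E).
  apply: ge0_subset_integral => //.
  - apply/measurable_EFinP; apply: subspace_continuous_measurable_fun => //.
  - by move=> z /=; rewrite in_itv/= => /andP[z0 _]; rewrite lee_fin heat_majorant_ge0.
  - exact: subset_itv_oo_cc.
(* The increment is at most 1 because Q T <= 0 and Q 0 = -1. *)
rewrite qE -EFinB lee_fin /Q mulr0 addr0 sqrtr_sqr !mulNr opprK mulfV ?normr_eq0//.
Qed.

(** The kernel for positive xi, with both inverses written as real powers so that joint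
    measurability follows from that of the power functions. *)
Let hk2 (p : R * R) : R :=
  p.1 * (expR (- (p.1 ^+ 2 / 4 * p.2 `^ (- 1))) * (2 * p.2) `^ (- (3 / 2))).

Let hk2E x xi : 0 < xi -> hk2 (x, xi) = heat_kernel x xi.
Proof.
move=> xi0; rewrite /hk2 /heat_kernel/= powR_inv1 ?(ltW xi0)// powRN.
by congr (_ * (expR (- _) / _)); field; rewrite gt_eqF.
Qed.

Let measurable_hk2 : measurable_fun setT hk2.
Proof.
apply: measurable_funM; first exact: measurable_fst.
apply: measurable_funM.
  apply: measurableT_comp => //; apply: measurableT_comp => //.
  apply: measurable_funM.
    by apply: measurable_funM => //; apply: measurable_funX; exact: measurable_fst.
  exact: (measurableT_comp (measurable_powR _) measurable_snd).
apply: (measurableT_comp (measurable_powR _)).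
by apply: measurable_funM => //; exact: measurable_snd.
Qed.

Lemma measurable_heat_kernel x T : measurable_fun `]0%R, T[ (heat_kernel x).
Proof.
have : measurable_fun `]0%R, T[ (fun xi => hk2 (x, xi)).
  by apply: measurable_funTS; exact: (measurable_fun_pair2 _ measurable_hk2).
apply: eq_measurable_fun => xi; rewrite inE/= in_itv/= => /andP[xi0 _].
by rewrite hk2E.
Qed.

(** The bound is Gaussian in x and stays finite at x = 0, although the kernel then concentrates near
    xi = 0. This is what makes final states uniformly dominated on the whole line. *)
Lemma heat_kernel_integral_le x T : 0 < T ->
  (\int[mu]_(xi in `]0%R, T[) `|heat_kernel x xi|%:E <=
    (64 * expR (- (x ^+ 2 / (8 * T))))%:E)%E.
Proof.
move=> T0; set C := 64 * _; have C0 : 0 <= C by rewrite mulr_ge0 ?expR_ge0.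
have [->|x0] := eqVneq x 0.
  under eq_integral do rewrite /heat_kernel mul0r normr0.
  by rewrite integral0 lee_fin.
have mq : measurable_fun `]0%R, T[ (heat_majorant x).
  apply: open_continuous_measurable_fun => // xi; rewrite inE/= in_itv/= => /andP[xi0 _].
  by apply: heat_majorant_continuous => //; exact: ltW.
apply: (@le_trans _ _ (\int[mu]_(xi in `]0%R, T[) (C%:E * (heat_majorant x xi)%:E))%E).
  apply: ge0_le_integral => //.
  - by apply/measurable_EFinP; apply: measurableT_comp => //; exact: measurable_heat_kernel.
  - by apply/measurable_EFinP; exact: measurable_funM.
  - move=> xi; rewrite /= in_itv/= => /andP[xi0 xiT].
    by rewrite -EFinM lee_fin heat_kernel_le.
rewrite ge0_integralZl_EFin//; last 2 first.
- by move=> xi; rewrite /= in_itv/= => /andP[xi0 _]; rewrite lee_fin heat_majorant_ge0// ltW.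
- exact/measurable_EFinP.
by rewrite -[leRHS]mule1 lee_pmul2l ?lte_fin ?mulr_gt0 ?expR_gt0// heat_majorant_integral_le1.
Qed.

Lemma integrable_heat_kernel x T : 0 < T ->
  mu.-integrable `]0%R, T[ (EFin \o heat_kernel x).
Proof.
move=> T0; apply/integrableP; split.
  by apply/measurable_EFinP; exact: measurable_heat_kernel.
by apply: le_lt_trans (heat_kernel_integral_le x T0) _; rewrite ltry.
Qed.

Lemma continuous_heat_kernel x xi : 0 < xi -> {for xi, continuous (heat_kernel x)}.
Proof.
move=> xi0.
have c2 : {for xi, continuous (fun z : R => 2 * z)}.
  by apply: (@continuousM R R (cst 2) id); [exact: cvg_cst|exact: cvg_id].
have c4 : {for xi, continuous (fun z : R => 4 * z)}.
  by apply: (@continuousM R R (cst 4) id); [exact: cvg_cst|exact: cvg_id].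
apply: (@continuousM R R (cst x)); first exact: cvg_cst.
apply: continuousM.
  apply: (@continuous_comp R R R (fun z => - (x ^+ 2 / (4 * z))) expR); last exact: continuous_expR.
  apply: (@continuousN R R R (fun z => x ^+ 2 / (4 * z))).
  apply: (@continuousM R R (cst (x ^+ 2))); first exact: cvg_cst.
  by apply: continuousV => //; rewrite mulf_neq0// gt_eqF.
apply: continuousV; first by rewrite gt_eqF// powR_gt0// mulr_gt0.
apply: (@continuous_comp R R R (fun z => 2 * z) (fun z => z `^ (3 / 2))) => //.
apply: differentiable_continuous; apply/derivable1_diffP.
by have [] := is_derive1_powR (3 / 2) (mulr_gt0 (ltr0Sn _ 1) xi0 : 0 < 2 * xi :> R).
Qed.

Lemma integrable_gauss_moment xi m : 0 < xi ->
  mu.-integrable setT (EFin \o (fun x => x ^+ m * expR (- (x ^+ 2 / (4 * xi))))).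
Proof.
move=> xi0; have b0 : 0 < (4 * xi)^-1 :> R by rewrite invr_gt0 mulr_gt0.
have := integrable_gaussM m b0; congr (_.-integrable _ _).
by apply/funext => x /=; rewrite [(4 * xi)^-1 * _]mulrC.
Qed.

(** The identity behind the normalisation of [omega]: odd moments in x of the kernel are monomials
    in xi, so odd moments of a final state are power moments of its control. *)
Lemma integral_heat_kernel_moment xi n : 0 < xi ->
  Num.sqrt (2 / pi) * \int[mu]_(x in `]0%R, +oo[) (x ^+ (2 * n + 1) * heat_kernel x xi) =
  (2 * n + 1)`!%:R / n`!%:R * xi ^+ n.
Proof.
move=> xi0; rewrite (@eq_Rintegral _ _ R mu _ (fun x => ((2 * xi) `^ (3 / 2))^-1 *
  (x ^+ (2 * n + 2) * expR (- (x ^+ 2 / (4 * xi)))))); last first.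
  move=> x _; rewrite /heat_kernel .
  have -> : x ^+ (2 * n + 2) = x ^+ (2 * n + 1) * x by rewrite -exprSr -addnS.
  by ring.
rewrite RintegralZl//; last first.
  exact: integrableS (integrable_gauss_moment (2 * n + 2) xi0).
rewrite -/(gauss_moment xi (2 * n + 2)) gauss_moment_even// powR32 ?mulr_ge0 ?(ltW xi0)//.
(* The first factor cancels sqrt (2 / pi), the second the root in (2 xi)^(3/2). *)
have -> : Num.sqrt (pi * xi) = Num.sqrt (pi / 2) * Num.sqrt (2 * xi).
  rewrite -sqrtrM ?divr_ge0 ?pi_ge0//; congr Num.sqrt; by field.
have s0 : Num.sqrt (2 * xi) != 0 by rewrite gt_eqF// sqrtr_gt0 mulr_gt0.
have : Num.sqrt (2 / pi) * Num.sqrt (pi / 2) = 1 :> R.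
  rewrite -sqrtrM ?divr_ge0 ?pi_ge0// (_ : 2 / pi * (pi / 2) = 1) ?sqrtr1//.
  by rewrite mulrA divfK ?divff// gt_eqF// pi_gt0.
set A := Num.sqrt (2 / pi); set B := Num.sqrt (pi / 2) => AB.
transitivity ((A * B) * ((2 * n + 1)`!%:R / n`!%:R * xi ^+ n)); last by rewrite AB mul1r.
by field; rewrite pnatr_eq0 -lt0n fact_gt0 s0 gt_eqF.
Qed.

Lemma heat_kernel_jointly_measurable :
  exists2 k : R * R -> R, measurable_fun setT k &
    forall x xi, 0 < xi -> k (x, xi) = heat_kernel x xi.
Proof. by exists hk2. Qed.

Lemma heat_kernelN x xi : heat_kernel (- x) xi = - heat_kernel x xi.
Proof. by rewrite /heat_kernel sqrrN mulNr. Qed.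

End heat_kernel.

(** * Final states of real controls *)

(** Every section, not merely almost every one, is assumed integrable: then all inner integrals are
    finite, and the real-valued ones agree pointwise with the extended ones to which Fubini
    applies. *)
Lemma Rintegral_fubini (R : realType) (f : R * R -> R) :
  let mu := @lebesgue_measure R in
  measurable_fun setT f ->
  (\int[mu]_x \int[mu]_y `|f (x, y)|%:E < +oo)%E ->
  (forall x, mu.-integrable setT (EFin \o (fun y => f (x, y)))) ->
  (forall y, mu.-integrable setT (EFin \o (fun x => f (x, y)))) ->
  mu.-integrable setT (EFin \o (fun x => \int[mu]_y f (x, y))) /\
  \int[mu]_x (\int[mu]_y f (x, y)) = \int[mu]_y (\int[mu]_x f (x, y)).
Proof.
move=> mu mf f_lty if1 if2.
have mEf : measurable_fun setT (EFin \o f) by exact/measurable_EFinP.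
have intf : (mu \x mu)%E.-integrable setT (EFin \o f) by apply/integrable12ltyP.
have E1 x : (\int[mu]_y (f (x, y))%:E = (\int[mu]_y f (x, y))%:E)%E.
  by rewrite /Rintegral fineK//; exact: integrable_fin_num (if1 x).
have E2 y : (\int[mu]_x (f (x, y))%:E = (\int[mu]_x f (x, y))%:E)%E.
  by rewrite /Rintegral fineK//; exact: integrable_fin_num (if2 y).
split.
  have := integrable_fubini_F intf; congr (_.-integrable _ _).
  by apply/funext => x; exact: E1.
transitivity (fine (\int[mu]_x \int[mu]_y (f (x, y))%:E)%E).
  by congr fine; apply: eq_integral => x _; rewrite E1.
transitivity (fine (\int[mu]_y \int[mu]_x (f (x, y))%:E)%E).
  by congr fine; exact: (Fubini intf).
by congr fine; apply: eq_integral => x _; rewrite E2.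
Qed.

Lemma integrable_cst_itv (R : realType) (a b c : R) :
  (@lebesgue_measure R).-integrable `]a, b[ (EFin \o cst c).
Proof.
apply: measurable_bounded_integrable => //.
  by rewrite /= lebesgue_measure_itv/=; case: ifP => // _; rewrite -EFinB ltry.
by exists `|c|; split; [exact: num_real|move=> M cM x _ /=; exact: ltW].
Qed.

(** Against a polynomial the integrals of u N are eventually constant in N. Replacing f by a
    polynomial costs at most L times the L^1 distance, uniformly in N, so the sequence is Cauchy. As
    f may have no limits at the ends of the interval, the approximation is made in L^1. *)
Lemma cvg_integral_of_moments (R : realType) (T L M : R) (u : nat -> R -> R)
    (w : nat -> R) (f : R -> R) :
  let mu := @lebesgue_measure R in
  0 < T -> (forall N, measurable_fun `]0, T[ (u N)) ->
  (forall N xi, `]0, T[%classic xi -> `|u N xi| <= L) ->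
  (forall n N, (n <= N)%N -> \int[mu]_(xi in `]0, T[) (xi ^+ n * u N xi) = w n) ->
  (forall xi, `]0, T[%classic xi -> `|f xi| <= M) ->
  (forall xi, `]0, T[%classic xi -> {for xi, continuous f}) ->
  cvgn (fun N => \int[mu]_(xi in `]0, T[) (f xi * u N xi)).
Proof.
move=> mu T0 meas_u uL uw fM cf.
have IT2 : `]0%R, T[%classic (T / 2).
  by rewrite /= in_itv/= divr_gt0// ltr_pdivrMr// mulr_natr mulr2n ltrDl.
have M0 : 0 <= M := le_trans (normr_ge0 _) (fM _ IT2).
have L0 : 0 <= L := le_trans (normr_ge0 _) (uL 0 _ IT2).
have mf : measurable_fun `]0%R, T[%classic f.
  by apply: open_continuous_measurable_fun => // xi /[!inE]; exact: cf.
(* Rescaling to the unit interval, with value 0 off its interior, gives a function bounded by M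
   everywhere and continuous at each interior point. *)
pose g : R -> R := (fun t => f (T * t)) \_ `]0, 1[.
have I01 t : (`]0, 1[%classic : set R) t -> `]0%R, T[%classic (T * t).
  by rewrite /= !in_itv/= => /andP[t0 t1]; rewrite mulr_gt0//= gtr_pMr.
have gM t : `|g t| <= M.
  by rewrite /g patchE; case: ifPn => [/[!inE]/I01/fM//|_]; rewrite normr0.
pose P m xi := (bernstein g m).[xi / T].
have I01' xi : `]0%R, T[%classic xi -> 0 < xi / T < 1.
  by rewrite /= in_itv/= => /andP[xi0 xiT]; rewrite divr_gt0//= ltr_pdivrMr// mul1r.
have PM m xi : `]0%R, T[%classic xi -> `|P m xi| <= M.
  move=> /I01' /andP[xi0 xi1]; apply: (bernstein_bounded _ gM).
  by rewrite !ltW.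
have mP m : measurable_fun setT (P m).
  apply: (measurableT_comp (continuous_measurable_fun (@continuous_horner R (bernstein g m)))).
  exact: measurable_funM.
have P_f xi : `]0%R, T[%classic xi -> P m xi @[m --> \oo] --> f xi.
  move=> Ixi; have /andP[t0 t1] := I01' _ Ixi.
  have -> : f xi = g (xi / T).
    rewrite /g patchE mem_set/= ?in_itv/= ?t0//.
    by rewrite mulrC divfK// gt_eqF.
  apply: (bernstein_cvg gM); first by rewrite !ltW.
  have Txi : T * (xi / T) = xi by rewrite mulrC divfK// gt_eqF.
  have gE : \forall z \near xi / T, f (T * z) = g z.
    have : nbhs (xi / T) (`]0, 1[%classic : set R).
      by apply: open_nbhs_nbhs; split; [exact: itv_open|rewrite /= in_itv/= t0].
    by apply: filterS => z z01; rewrite /g patchE mem_set.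
  have cfT : {for xi / T, continuous (fun z => f (T * z))}.
    apply: (@continuous_comp R R R (fun z => T * z) f).
      by apply: (@continuousM R R (cst T) id); [exact: cvg_cst|exact: cvg_id].
    by rewrite Txi; exact: cf.
  apply: cvg_trans (near_eq_cvg gE) _; rewrite -(nbhs_singleton gE).
  exact: cfT.
pose d m := \int[mu]_(xi in `]0%R, T[) `|f xi - P m xi|.
have mfP m : measurable_fun `]0%R, T[%classic (fun xi => f xi - P m xi).
  by apply: measurable_funB => //; exact: measurable_funTS.
have fPM m xi : `]0%R, T[%classic xi -> `|f xi - P m xi| <= M + M.
  by move=> Ixi; rewrite (le_trans (ler_normB _ _))// lerD ?fM ?PM.
have d0 : d m @[m --> \oo] --> 0.
  have I0 : \int[mu]_(xi in `]0%R, T[) (0 : R) = 0 by rewrite Rintegral_cst// mul0r.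
  rewrite -[X in _ --> X]I0.
  apply: (@Rintegral_dominated_cvg _ _ _ mu `]0%R, T[%classic _ _ (cst (M + M))) => //.
  - by move=> m; apply: measurableT_comp => //; exact: mfP.
  - apply: nearW => xi Ixi /=; apply/norm_cvg0P.
    rewrite -(subrr (f xi)); apply: cvgB; [exact: cvg_cst|exact: P_f].
  - exact: integrable_cst_itv.
  - by move=> m xi Ixi; rewrite normr_id fPM.
have ifu N : mu.-integrable `]0%R, T[%classic (EFin \o (fun xi => f xi * u N xi)).
  apply: (@dominated_integrable_real _ _ _ mu `]0%R, T[%classic _ (cst (M * L))) => //.
  - exact: (measurable_funM mf (meas_u N)).
  - by move=> xi Ixi; rewrite normrM ler_pM ?fM ?uL.
  - exact: integrable_cst_itv.
have iPu m N : mu.-integrable `]0%R, T[%classic (EFin \o (fun xi => P m xi * u N xi)).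
  apply: (@dominated_integrable_real _ _ _ mu `]0%R, T[%classic _ (cst (M * L))) => //.
  - exact: (measurable_funM (measurable_funTS (mP m)) (meas_u N)).
  - by move=> xi Ixi; rewrite normrM ler_pM ?PM ?uL.
  - exact: integrable_cst_itv.
have approx m N : `|\int[mu]_(xi in `]0%R, T[) (f xi * u N xi) -
    \int[mu]_(xi in `]0%R, T[) (P m xi * u N xi)| <= d m * L.
  rewrite -RintegralB//; apply: le_trans (le_normr_Rintegral _ _) _ => //.
    by apply: (integrableB _ (ifu N) (iPu m N)).
  have iabs : mu.-integrable `]0%R, T[%classic (EFin \o (fun xi => `|f xi - P m xi|)).
    apply: (@dominated_integrable_real _ _ _ mu `]0%R, T[%classic _ (cst (M + M))) => //.
    - by apply: measurableT_comp => //; exact: mfP.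
    - by move=> xi Ixi; rewrite normr_id fPM.
    - exact: integrable_cst_itv.
  rewrite -RintegralZr//; apply: le_Rintegral => //.
  - by apply: integrable_norm; apply: (integrableB _ (ifu N) (iPu m N)).
  - by have /(integrableZr _ L) := iabs; apply.
  - by move=> xi Ixi; rewrite -mulrBl normrM ler_wpM2l// uL.
(* All exponents are below the size, so N at least the size puts every moment used in the stable
   range; the value no longer depends on N. *)
have polyE m N : (size (bernstein g m) <= N)%N ->
    \int[mu]_(xi in `]0%R, T[) (P m xi * u N xi) =
    \sum_(0 <= i < size (bernstein g m)) (bernstein g m)`_i * T ^- i * w i.
  move=> sN; pose F i xi := (bernstein g m)`_i * T ^- i * (xi ^+ i * u N xi).
  have iX i : mu.-integrable `]0%R, T[%classic (EFin \o (fun xi => xi ^+ i * u N xi)).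
    apply: (@dominated_integrable_real _ _ _ mu `]0%R, T[%classic _ (cst (T ^+ i * L))) => //.
    - by apply: measurable_funM (meas_u N); apply: measurable_funTS; exact: measurable_funX.
    - move=> xi Ixi; rewrite normrM normrX ler_pM ?uL ?exprn_ge0//.
      move: Ixi; rewrite /= in_itv/= => /andP[xi0 xiT].
      by rewrite gtr0_norm// lerXn2r// ?nnegrE ?(ltW xi0) ?(ltW xiT) ?(ltW T0).
    - exact: integrable_cst_itv.
  have iF i : mu.-integrable `]0%R, T[%classic (EFin \o F i).
    by have /(integrableZl _ ((bernstein g m)`_i * T ^- i)) := iX i; apply.
  rewrite (@eq_Rintegral _ _ R mu `]0%R, T[%classic
    (fun xi => \sum_(0 <= i < size (bernstein g m)) F i xi)); last first.
    move=> xi _; rewrite /P horner_coef mulr_suml big_mkord.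
    by apply: eq_bigr => i _; rewrite /F expr_div_n -!mulrA; congr (_ * _); rewrite mulrCA.
  rewrite Rintegral_sum//; apply: eq_big_nat => i /andP[_ si].
  by rewrite RintegralZl// uw// (leq_trans (ltnW si)).
apply/cauchy_cvgP/cauchy_exP => e /= e0.
have [m dm] : exists m, d m * L < e / 2.
  have : d m * L @[m --> \oo] --> 0 * L by apply: cvgM; [exact: d0|exact: cvg_cst].
  rewrite mul0r => /cvgrPdist_lt /(_ (e / 2)); rewrite divr_gt0// => /(_ isT).
  move=> -[m _ /(_ m (leqnn m))] /=; rewrite sub0r normrN => h.
  by exists m; apply: le_lt_trans h; exact: ler_norm.
(* The integrals at N0 and at any later N are both within e / 2 of the common value of the
   polynomial integrals. *)
pose N0 := size (bernstein g m).
have h0 := approx m N0; rewrite polyE// in h0.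
exists (\int[mu]_(xi in `]0, T[) (f xi * u N0 xi)).
suff : \forall N \near \oo, ball (\int[mu]_(xi in `]0, T[) (f xi * u N0 xi)) e
  (\int[mu]_(xi in `]0, T[) (f xi * u N xi)) by [].
exists N0 => // N /= sN; have hN := approx m N; rewrite polyE// in hN.
rewrite /ball/=; move: h0 hN; rewrite !ler_norml => h0 hN.
by rewrite ltr_norml; lra.
Qed.

Section final_value.
Variables (R : realType) (T L : R) (u : R -> R).
Notation mu := (@lebesgue_measure R).
Hypothesis T_gt0 : 0 < T.
Hypothesis meas_u : measurable_fun `]0, T[ u.
Hypothesis uL : forall xi, `]0, T[%classic xi -> `|u xi| <= L.
Implicit Types (x xi : R).

Definition final_value x :=
  Num.sqrt (2 / pi) * \int[mu]_(xi in `]0%R, T[) (heat_kernel x xi * u xi).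

Let L_ge0 : 0 <= L.
Proof.
have /uL : `]0, T[%classic (T / 2).
  by rewrite /= in_itv/= divr_gt0// ltr_pdivrMr// mulr_natr mulr2n ltrDl.
exact: le_trans.
Qed.

Lemma integrable_heat_kernelM x :
  mu.-integrable `]0, T[ (EFin \o (fun xi => heat_kernel x xi * u xi)).
Proof.
apply: (@dominated_integrable_real _ _ _ mu _ _ (fun xi => `|heat_kernel x xi| * L)) => //.
- exact: (measurable_funM (@measurable_heat_kernel R x T) meas_u).
- by move=> xi Ixi; rewrite normrM ler_wpM2l// uL.
- have /integrable_norm/(integrableZr _ L) := integrable_heat_kernel x T_gt0; exact.
Qed.

Lemma final_valueN x : final_value (- x) = - final_value x.
Proof.
rewrite /final_value -mulrN; congr (_ * _); rewrite -mulN1r -RintegralZl//; last first.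
  exact: integrable_heat_kernelM.
by apply: eq_Rintegral => xi _; rewrite heat_kernelN mulNr mulN1r.
Qed.

Let normed_integral_le x :
  (\int[mu]_(xi in `]0%R, T[) `|heat_kernel x xi * u xi|%:E <=
    (L * (64 * expR (- (x ^+ 2 / (8 * T)))))%:E)%E.
Proof.
apply: (@le_trans _ _ (\int[mu]_(xi in `]0%R, T[) (L%:E * `|heat_kernel x xi|%:E))%E).
  apply: ge0_le_integral => //.
  - apply/measurable_EFinP; apply: measurableT_comp => //.
    exact: (measurable_funM (@measurable_heat_kernel R x T) meas_u).
  - apply/measurable_EFinP; apply: measurable_funM => //.
    by apply: measurableT_comp => //; exact: measurable_heat_kernel.
  - by move=> xi Ixi; rewrite -EFinM lee_fin normrM mulrC ler_wpM2r// uL.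
rewrite ge0_integralZl_EFin//; last first.
  apply/measurable_EFinP; apply: measurableT_comp => //.
  exact: measurable_heat_kernel.
by rewrite EFinM lee_wpmul2l ?lee_fin// heat_kernel_integral_le.
Qed.

Lemma final_value_le x :
  `|final_value x| <= Num.sqrt (2 / pi) * L * 64 * expR (- ((8 * T)^-1 * x ^+ 2)).
Proof.
rewrite /final_value normrM ger0_norm ?sqrtr_ge0// -!mulrA ler_wpM2l ?sqrtr_ge0//.
apply: le_trans (le_normr_Rintegral _ (integrable_heat_kernelM x)) _ => //.
rewrite -lee_fin [_^-1 * _]mulrC; apply: le_trans (normed_integral_le x).
rewrite /Rintegral fineK//; apply: integrable_fin_num => //.
by have /integrable_norm := integrable_heat_kernelM x.
Qed.

(** The power m and the set A serve two uses: m = 0 on the whole line yields measurability of the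
    final state, odd m on the positive half-line its moments. *)
Let fubini_final_value m (A : set R) : measurable A ->
  mu.-integrable setT (EFin \o (fun x => x ^+ m * \1_A x *
    \int[mu]_(xi in `]0%R, T[) (heat_kernel x xi * u xi))) /\
  \int[mu]_x (x ^+ m * \1_A x *
    \int[mu]_(xi in `]0%R, T[) (heat_kernel x xi * u xi)) =
  \int[mu]_(xi in `]0%R, T[)
    (u xi * \int[mu]_(x in A) (x ^+ m * heat_kernel x xi)).
Proof.
move=> mA; have [k mk kE] := heat_kernel_jointly_measurable R.
pose v := u \_ `]0%R, T[.
have mv : measurable_fun setT v by apply: (iffLR (measurable_restrictT u _)).
(* Extending the control by zero turns both integrals into integrals over the line and hides the
   values of k at xi <= 0. *)
pose f (p : R * R) := p.1 ^+ m * \1_A p.1 * (k p * v p.2).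
have fE x xi : f (x, xi) = x ^+ m * \1_A x * ((fun xi => heat_kernel x xi * u xi) \_ `]0%R, T[) xi.
  rewrite /f /v !patchE/=; case: ifPn => [/[!inE]/=|_]; last by rewrite !mulr0.
  by rewrite in_itv/= => /andP[xi0 _]; rewrite kE.
have fE2 x xi : f (x, xi) = v xi * ((fun x => x ^+ m * heat_kernel x xi) \_ A) x.
  rewrite /f /v !patchE/= indicE; case: ifPn => [/[!inE]/=|_]; last by rewrite !(mulr0, mul0r).
  rewrite in_itv/= => /andP[xi0 _]; rewrite kE//.
  by case: ifPn; rewrite ?(mulr1, mulr0, mul0r)// mulrA mulrC.
have mf : measurable_fun setT f.
  apply: measurable_funM.
    apply: measurable_funM; first by apply: measurable_funX; exact: measurable_fst.
    by apply: measurableT_comp measurable_fst; exact: measurable_indic.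
  apply: measurable_funM => //.
  exact: (measurableT_comp mv measurable_snd).
have ihku x : mu.-integrable setT
    (EFin \o ((fun xi => heat_kernel x xi * u xi) \_ `]0%R, T[)).
  by have := integrable_heat_kernelM x; rewrite integrable_mkcond//= restrict_EFin.
have i1 x : mu.-integrable setT (EFin \o (fun xi => f (x, xi))).
  have /(integrableZl _ (x ^+ m * \1_A x)) h' := ihku x.
  move: (h' measurableT); congr (_.-integrable _ _).
  by apply/funext => xi /=; rewrite fE EFinM.
have ihk xi : 0 < xi -> mu.-integrable setT
    (EFin \o (fun x => x ^+ m * heat_kernel x xi)).
  move=> xi0; have /(integrableZr _ (((2 * xi) `^ (3 / 2))^-1)) :=
    integrable_gauss_moment m.+1 xi0.
  move=> /(_ measurableT); congr (_.-integrable _ _).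
  by apply/funext => x /=; rewrite -EFinM /heat_kernel exprSr !mulrA.
have ihkA xi : 0 < xi ->
    mu.-integrable setT (EFin \o ((fun x => x ^+ m * heat_kernel x xi) \_ A)).
  move=> xi0; rewrite -restrict_EFin -integrable_mkcond//.
  by apply: integrableS (ihk _ xi0).
have i2 xi : mu.-integrable setT (EFin \o (fun x => f (x, xi))).
  have [Ixi|nIxi] := boolP (xi \in `]0%R, T[%classic); last first.
    rewrite (_ : _ \o _ = cst 0%E); first exact: integrable0.
    by apply/funext => x /=; rewrite fE2 /v patchE (negbTE nIxi) mul0r.
  have xi0 : 0 < xi by move: Ixi; rewrite inE/= in_itv/= => /andP[].
  have /(integrableZl _ (v xi)) h' := ihkA _ xi0.
  move: (h' measurableT); congr (_.-integrable _ _).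
  by apply/funext => x /=; rewrite fE2 EFinM.
(* The inner integral is Gaussian in x by the L^1 bound on the kernel, so the factor |x|^m is
   harmless. *)
have flty : (\int[mu]_x \int[mu]_xi `|f (x, xi)|%:E < +oo)%E.
  have T8 : 0 < (8 * T)^-1 by rewrite invr_gt0 mulr_gt0.
  pose G x := (`|x| ^+ m * expR (- ((8 * T)^-1 * x ^+ 2))) * (L * 64).
  have iG : mu.-integrable setT (EFin \o G).
    have /integrable_norm/(integrableZr _ (L * 64)) := integrable_gaussM m T8.
    move=> /(_ measurableT); congr (_.-integrable _ _).
    by apply/funext => x /=; rewrite -EFinM normrM normrX (ger0_norm (expR_ge0 _)).
  apply: (@le_lt_trans _ _ (\int[mu]_x (G x)%:E)%E); last first.
    have /integrableP[_] := iG; under eq_integral => x _.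
      rewrite /= ger0_norm ?mulr_ge0 ?exprn_ge0 ?expR_ge0//; over.
    by [].
  apply: ge0_le_integral => //.
  - by move=> x _; exact: integral_ge0.
  - apply: (measurable_fun_fubini_tonelli_F (m2 := mu) (fun p => `|f p|%:E)) => //.
    by apply/measurable_EFinP; exact: measurableT_comp.
  - exact: measurable_int iG.
  - move=> x _.
    have nfE xi : (`|f (x, xi)|%:E = (`|x| ^+ m * \1_A x)%:E *
        ((fun xi => `|heat_kernel x xi * u xi|%:E) \_ `]0%R, T[) xi)%E.
      rewrite fE normrM [`|_ * \1_A x|]normrM normrX [`|\1_A x|]ger0_norm//.
      by rewrite patchE [in RHS]patchE; case: ifP; rewrite ?normr0 ?mulr0 ?mule0 ?EFinM.
    under eq_integral do rewrite nfE.
    rewrite ge0_integralZl_EFin//; last 2 first.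
    + by move=> xi _; rewrite patchE; case: ifP.
    + apply: (iffLR (measurable_restrictT _ _)) => //; apply/measurable_EFinP.
      apply: measurableT_comp => //.
      exact: (measurable_funM (@measurable_heat_kernel R x T) meas_u).
    rewrite -integral_mkcond.
    apply: le_trans (lee_wpmul2l _ (normed_integral_le x)) _.
      by rewrite lee_fin mulr_ge0 ?exprn_ge0.
    rewrite -EFinM lee_fin /G -[leRHS]mulrA.
    rewrite -[leLHS]mulrA ler_wpM2l ?exprn_ge0//.
    rewrite [_ / _]mulrC -[leRHS]mul1r [leRHS](_ : _ = 1 * (L * (64 * expR (- ((8 * T)^-1 * x ^+ 2))))).
      by rewrite ler_wpM2r ?mulr_ge0 ?expR_ge0// indicE; case: (_ \in _).
    by ring.
have [iF FE] := Rintegral_fubini mf flty i1 i2.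
have F1 x : \int[mu]_xi f (x, xi) =
    x ^+ m * \1_A x * \int[mu]_(xi in `]0%R, T[) (heat_kernel x xi * u xi).
  under eq_Rintegral do rewrite fE.
  rewrite RintegralZl; [|exact: measurableT|exact: ihku].
  by rewrite -Rintegral_mkcond.
split.
  move: iF; congr (_.-integrable _ _); by apply/funext => x /=; rewrite F1.
under eq_Rintegral do rewrite -F1.
rewrite FE [RHS]Rintegral_mkcond; apply: eq_Rintegral => xi _.
under eq_Rintegral do rewrite fE2.
rewrite patchE /v patchE; case: ifPn => [Ixi|nIxi]; last first.
  under eq_Rintegral do rewrite mul0r.
  by rewrite Rintegral_cst// mul0r.
have xi0 : 0 < xi by move: Ixi; rewrite inE/= in_itv/= => /andP[].
rewrite RintegralZl; [|exact: measurableT|exact: ihkA].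
by rewrite -Rintegral_mkcond.
Qed.

(** Measurability in x comes with the integrability half of Fubini. *)
Lemma measurable_final_value : measurable_fun setT final_value.
Proof.
have [+ _] := @fubini_final_value 0 setT measurableT.
move=> /measurable_int/measurable_EFinP h.
apply: measurable_funM => //; move: h; congr (measurable_fun _ _).
by apply/funext => x; rewrite expr0 indicT !mul1r.
Qed.

Lemma final_value_moment n :
  \int[mu]_(x in `]0%R, +oo[) (x ^+ (2 * n + 1) * final_value x) =
  (2 * n + 1)`!%:R / n`!%:R * \int[mu]_(xi in `]0%R, T[) (xi ^+ n * u xi).
Proof.
have [iF FE] := @fubini_final_value (2 * n + 1) `]0%R, +oo[%classic (measurable_itv _).
rewrite Rintegral_mkcond.
rewrite (@eq_Rintegral _ _ R mu _ (fun x => Num.sqrt (2 / pi) *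
  (x ^+ (2 * n + 1) * \1_(`]0%R, +oo[) x *
    \int[mu]_(xi in `]0%R, T[) (heat_kernel x xi * u xi)))); last first.
  move=> x _; rewrite patchE /final_value indicE; case: ifPn => _.
    by rewrite mulr1 mulrCA.
  by rewrite !(mulr0, mul0r).
rewrite RintegralZl// FE.
have iu : mu.-integrable `]0, T[ (EFin \o (fun xi => xi ^+ n * u xi)).
  apply: (@dominated_integrable_real _ _ _ mu _ _ (cst (T ^+ n * L))).
  - by [].
  - by apply: measurable_funM meas_u; apply: measurable_funTS; exact: measurable_funX.
  - move=> xi Ixi; rewrite normrM normrX; apply: ler_pM; rewrite ?uL ?exprn_ge0//.
    move: Ixi; rewrite /= in_itv/= => /andP[xi0 xiT].
    by rewrite gtr0_norm//; apply: lerXn2r (ltW xiT); rewrite nnegrE ltW.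
  - exact: integrable_cst_itv.
have pi2 : Num.sqrt (2 / pi) != 0 :> R.
  by rewrite gt_eqF// sqrtr_gt0; apply: divr_gt0; rewrite ?pi_gt0.
rewrite (@eq_Rintegral _ _ R mu _ (fun xi => ((Num.sqrt (2 / pi))^-1 *
  ((2 * n + 1)`!%:R / n`!%:R)) * (xi ^+ n * u xi))); last first.
  move=> xi /[!inE]/=; rewrite in_itv/= => /andP[xi0 _].
  have := integral_heat_kernel_moment n xi0 => /(congr1 (fun z => (Num.sqrt (2 / pi))^-1 * z)).
  rewrite mulKf// => ->; ring.
by rewrite RintegralZl; [rewrite !mulrA mulfV ?mul1r|by []|exact: iu].
Qed.

End final_value.

(** The limit V exists at every x; what has to be shown is that it is h. Both have the same odd
    moments, so determinacy applies to h - V, with V decaying twice as fast as the weight exp (c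
    x^2) grows. *)
Lemma final_value_cvg_ae (R : realType) (T L : R) (u : nat -> R -> R)
    (w : nat -> R) (h : R -> R) :
  let mu := @lebesgue_measure R in
  0 < T -> (forall N, measurable_fun `]0, T[ (u N)) ->
  (forall N xi, `]0, T[%classic xi -> `|u N xi| <= L) ->
  (forall n N, (n <= N)%N -> \int[mu]_(xi in `]0, T[) (xi ^+ n * u N xi) = w n) ->
  measurable_fun setT h ->
  mu.-integrable `]0, +oo[ (EFin \o (fun x => expR ((16 * T)^-1 * x ^+ 2) * h x)) ->
  (forall n, \int[mu]_(x in `]0, +oo[) (x ^+ (2 * n + 1) * h x) =
    (2 * n + 1)`!%:R / n`!%:R * w n) ->
  {ae mu, forall x, 0 < x -> final_value T (u N) x @[N --> \oo] --> h x}.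
Proof.
move=> mu T0 meas_u uL uw mh ih hw.
pose c := (16 * T)^-1.
have c0 : 0 < c by rewrite invr_gt0 mulr_gt0.
have c2 : (8 * T)^-1 = 2 * c by rewrite /c; field; rewrite gt_eqF.
pose C := Num.sqrt (2 / pi) * L * 64.
pose V x := limn (fun N => final_value T (u N) x).
have FV x : final_value T (u N) x @[N --> \oo] --> V x.
  (* The bound 64 / x^2 says nothing at x = 0, but there the kernel vanishes identically. *)
  have [->|x0] := eqVneq x 0.
    rewrite /V (_ : (fun _ => _) = cst 0); first exact: is_cvg_cst.
    apply/funext => N; rewrite /final_value.
    under eq_Rintegral do rewrite /heat_kernel mul0r mul0r.
    by rewrite Rintegral_cst// mul0r mulr0.
  have cvk : cvgn (fun N => \int[mu]_(xi in `]0, T[) (heat_kernel x xi * u N xi)).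
    apply: (@cvg_integral_of_moments R T L (64 / x ^+ 2) u w) => //.
      by move=> xi; rewrite /= in_itv/= => /andP[xi0 _]; exact: heat_kernel_le_inv_sqr.
    by move=> xi; rewrite /= in_itv/= => /andP[xi0 _]; exact: continuous_heat_kernel.
  exact: (is_cvgM (is_cvg_cst _) cvk).
have FC N x : `|final_value T (u N) x| <= C * expR (- (2 * c * x ^+ 2)).
  by rewrite -c2; exact: (final_value_le T0 (meas_u N) (uL N)).
have VC x : `|V x| <= C * expR (- (2 * c * x ^+ 2)).
  have nFV : `|final_value T (u N) x| @[N --> \oo] --> `|V x| by exact: cvg_norm (FV x).
  rewrite -(cvg_lim (@Rhausdorff R) nFV); apply: limr_le.
    by apply/cvg_ex; exists `|V x|.
  by apply: nearW => N; exact: FC.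
have mF N : measurable_fun setT (final_value T (u N)).
  exact: (measurable_final_value T0 (meas_u N) (uL N)).
have mV : measurable_fun setT V.
  apply/measurable_EFinP; apply: (emeasurable_fun_cvg (fun N => EFin \o final_value T (u N))).
    by move=> N; exact/measurable_EFinP.
  by move=> x _; apply: cvg_EFin (FV x); exact: nearW.
have C0 : 0 <= C.
  by have := le_trans (normr_ge0 _) (VC 0); rewrite expr0n mulr0 oppr0 expR0 mulr1.
have mX n : measurable_fun setT (fun x : R => x ^+ n) by exact: measurable_funX.
have iXC n : mu.-integrable `]0, +oo[
    (EFin \o (fun x => C * `|x ^+ n * expR (- (2 * c * x ^+ 2))|)).
  have c20 : 0 < 2 * c by rewrite mulr_gt0.
  have i1 : mu.-integrable `]0, +oo[ (EFin \o (fun x => x ^+ n * expR (- (2 * c * x ^+ 2)))).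
    by apply: integrableS (integrable_gaussM n c20).
  by have /integrable_norm/(integrableZl _ C) := i1; apply.
have XC n (g : R -> R) x : (forall x, `|g x| <= C * expR (- (2 * c * x ^+ 2))) ->
    `|x ^+ n * g x| <= C * `|x ^+ n * expR (- (2 * c * x ^+ 2))|.
  move=> gC; rewrite !normrM mulrCA ler_wpM2l// (le_trans (gC x))//.
  by rewrite (ger0_norm (expR_ge0 _)).
have VM n : \int[mu]_(x in `]0, +oo[) (x ^+ (2 * n + 1) * V x) =
    (2 * n + 1)`!%:R / n`!%:R * w n.
  have : \int[mu]_(x in `]0, +oo[) (x ^+ (2 * n + 1) * final_value T (u N) x)
      @[N --> \oo] --> \int[mu]_(x in `]0, +oo[) (x ^+ (2 * n + 1) * V x).
    apply: (@Rintegral_dominated_cvg _ _ _ mu _ _ _ _ _ _ _ _ (iXC (2 * n + 1)%N)).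
    - exact: measurable_itv.
    - by move=> N; apply: measurable_funTS; exact: (measurable_funM (mX _) (mF N)).
    - by apply: measurable_funTS; exact: (measurable_funM (mX _) mV).
    - by apply: nearW => x _; exact: (cvgM (cvg_cst _) (FV x)).
    - by move=> N x _; apply: XC; exact: FC.
  move=> /(cvg_lim (@Rhausdorff R)) <-.
  (* The moment of order 2 n + 1 of the final states is constant from N = n on. *)
  apply: lim_near_cst => //; exists n => // N /= nN.
  by rewrite (final_value_moment T0 (meas_u N) (uL N)) uw.
have iV n : mu.-integrable `]0, +oo[ (EFin \o (fun x => x ^+ n * V x)).
  apply: (dominated_integrable_real _ _ _ (iXC n)).
  - exact: measurable_itv.
  - by apply: measurable_funTS; exact: (measurable_funM (mX _) mV).
  - by move=> x _; apply: XC; exact: VC.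
have ih' n : mu.-integrable `]0, +oo[ (EFin \o (fun x => x ^+ n * h x)).
  have [C1 C10 HC] := norm_exp_le_gauss n c0.
  apply: (@dominated_integrable_real _ _ _ mu _ _
    (fun x => C1 * `|expR (c * x ^+ 2) * h x|)).
  - exact: measurable_itv.
  - by apply: measurable_funTS; exact: (measurable_funM (mX _) mh).
  - move=> x _; rewrite !normrM mulrA ler_wpM2r// normrX (le_trans (HC x))//.
    by rewrite (ger0_norm (expR_ge0 _)).
  - by have /integrable_norm/(integrableZl _ C1) := ih; apply.
have /(@gauss_moments_determinate R (fun x => h x - V x) c c0) : measurable_fun setT (fun x => h x - V x).
  exact: measurable_funB.
have iw : mu.-integrable `]0, +oo[ (EFin \o (fun x => expR (c * x ^+ 2) * (h x - V x))).
  have iVe : mu.-integrable `]0, +oo[ (EFin \o (fun x => expR (c * x ^+ 2) * V x)).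
    apply: (@dominated_integrable_real _ _ _ mu _ _ (fun x => C * (x ^+ 0 * expR (- (c * x ^+ 2))))).
    - exact: measurable_itv.
    - apply: measurable_funTS; apply: measurable_funM mV.
      by apply: measurableT_comp => //; apply: measurable_funM => //; exact: mX.
    - move=> x _; rewrite normrM (ger0_norm (expR_ge0 _)) expr0 mul1r.
      apply: le_trans (ler_wpM2l (expR_ge0 _) (VC x)) _.
      rewrite mulrCA -expRD ler_wpM2l// ler_expR le_eqVlt; apply/orP; left; apply/eqP.
      by ring.
    - have i0 : mu.-integrable `]0, +oo[ (EFin \o (fun x => x ^+ 0 * expR (- (c * x ^+ 2)))).
        by apply: integrableS (integrable_gaussM 0 c0).
      by have /(integrableZl _ C) := i0; apply.
  rewrite (_ : (fun x => expR (c * x ^+ 2) * (h x - V x)) = fun x =>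
    expR (c * x ^+ 2) * h x - expR (c * x ^+ 2) * V x).
    by apply: (integrableB _ ih iVe).
  by apply/funext => x; rewrite mulrBr.
move=> /(_ iw) hV0.
have : {ae mu, forall x, 0 < x -> h x - V x = 0}.
  apply: hV0 => n.
  rewrite (_ : (fun x => x ^+ (2 * n + 1) * (h x - V x)) = fun x =>
    x ^+ (2 * n + 1) * h x - x ^+ (2 * n + 1) * V x); last first.
    by apply/funext => x; rewrite mulrBr.
  by rewrite RintegralB// hw VM subrr.
apply: filterS; first exact: (ae_filter_ringOfSetsType mu).
by move=> x h0 /h0/subr0_eq ->; exact: FV.
Qed.

(** * Complex controls *)

Lemma ae_opp (R : realType) (P : R -> Prop) :
  {ae @lebesgue_measure R, forall x, P x} ->
  {ae @lebesgue_measure R, forall x, P (- x)}.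
Proof.
move=> [A [mA A0 PA]]; exists (-%R @^-1` A); split.
- by rewrite -[X in measurable X]setTI; exact: (@oppr_measurable R setT measurableT A mA).
- by rewrite -[RHS]A0; exact: lebesgue_measureN.
- by move=> x nPx; apply: PA.
Qed.

Lemma norm_Loo_ae (R : realType) (T L : R) (v : R -> R[i]) :
  (norm_Loo T v <= L%:E)%E ->
  {ae @lebesgue_measure R, forall xi, `]0, T[%classic xi -> normc (v xi) <= L}.
Proof.
rewrite /norm_Loo unlock /Lnorm; case: ifPn => [_|]; last first.
  (* The norm is an essential supremum only on a space of positive measure; the interval (0, 1)
     shows that the line is one. *)
  move=> /negP; case; rewrite (@lt_le_trans _ _ (@lebesgue_measure R `]0, 1[))//.
    by rewrite /= lebesgue_measure_itv/= lte_fin ltr01 -EFinB subr0 lte_fin.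
  by apply: le_measure; rewrite ?inE.
move=> /ess_supP h; apply: filterS h => xi + Ixi; rewrite /= patchE mem_set//= lee_fin.
by apply: le_trans; exact: ler_norm.
Qed.

Section complex_components.
Variable R : realType.
Notation mu := (@lebesgue_measure R).
Implicit Types (z : R[i]) (r x : R).

Lemma Re_realM r z : complex.Re (r%:C * z) = r * complex.Re z.
Proof. by case: z => a b /=; rewrite mul0r subr0. Qed.

Lemma Im_realM r z : complex.Im (r%:C * z) = r * complex.Im z.
Proof. by case: z => a b /=; rewrite mul0r addr0. Qed.

Lemma normc_sqrt z : normc z = Num.sqrt (complex.Re z ^+ 2 + complex.Im z ^+ 2).
Proof. by case: z. Qed.

Lemma sqr_normcE z : normc z ^+ 2 = complex.Re z ^+ 2 + complex.Im z ^+ 2.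
Proof. by rewrite normc_sqrt sqr_sqrtr// addr_ge0 ?sqr_ge0. Qed.

Lemma normc_nneg z : 0 <= normc z.
Proof. by rewrite normc_sqrt sqrtr_ge0. Qed.

Lemma Re_le_normc z : `|complex.Re z| <= normc z.
Proof. by rewrite normc_sqrt -sqrtr_sqr ler_wsqrtr// lerDl sqr_ge0. Qed.

Lemma Im_le_normc z : `|complex.Im z| <= normc z.
Proof. by rewrite normc_sqrt -sqrtr_sqr ler_wsqrtr// lerDr sqr_ge0. Qed.

Lemma measurable_normc (D : set R) (f : R -> R[i]) : measurable D ->
  Cmeasurable D f -> measurable_fun D (fun x => normc (f x)).
Proof.
move=> mD [mRe mIm].
rewrite (_ : (fun x => normc (f x)) = fun x =>
  Num.sqrt (complex.Re (f x) ^+ 2 + complex.Im (f x) ^+ 2)); last first.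
  by apply/funext => x; rewrite normc_sqrt.
apply: (measurableT_comp (continuous_measurable_fun (@sqrt_continuous R))).
by apply: measurable_funD; exact: measurable_funX.
Qed.

End complex_components.

(** * Real and imaginary parts treated at once, as an abstract component *)

Section component.
Variables (R : realType) (pr : R[i] -> R).
Notation mu := (@lebesgue_measure R).
Hypothesis pr_le : forall z, `|pr z| <= normc z.
Hypothesis prM : forall (r : R) z, pr (r%:C * z) = r * pr z.
Hypothesis prN : forall z, pr (- z) = - pr z.
Hypothesis pr_integral : forall D f, pr (Cintegral D f) = \int[mu]_(x in D) pr (f x).
Hypothesis pr_measurable : forall D f, Cmeasurable D f ->
  measurable_fun D (fun x => pr (f x)).

(* The essential bound |v| <= L becomes an everywhere bound after cutting off
   a null set, which no integral sees. *)
Definition cutoff (L : R) (v : R -> R[i]) (x : R) : R :=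
  (normc (v x) <= L)%R%:R * pr (v x).

Section bounded_control.
Variables (T L : R) (v : R -> R[i]).
Hypothesis T_gt0 : 0 < T.
Hypothesis L_ge0 : 0 <= L.
Hypothesis mv : Cmeasurable `]0, T[ v.
Hypothesis vL : (norm_Loo T v <= L%:E)%E.

Lemma cutoff_bounded x : `|cutoff L v x| <= L.
Proof.
rewrite /cutoff; case: (leP (normc (v x)) L) => vxL.
  by rewrite mul1r (le_trans (pr_le _)).
by rewrite mul0r normr0.
Qed.

Lemma measurable_cutoff : measurable_fun `]0, T[ (cutoff L v).
Proof.
apply: measurable_funM; last exact: pr_measurable.
apply: measurableT_comp => //; apply: measurable_fun_ler => //.
exact: measurable_normc.
Qed.

Lemma integral_cutoff (g : R -> R) : measurable_fun `]0, T[ g ->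
  \int[mu]_(xi in `]0, T[) (g xi * pr (v xi)) =
  \int[mu]_(xi in `]0, T[) (g xi * cutoff L v xi).
Proof.
move=> mg; congr fine; apply: ae_eq_integral => //.
- by apply/measurable_EFinP; apply: measurable_funM => //; exact: pr_measurable.
- by apply/measurable_EFinP; apply: measurable_funM => //; exact: measurable_cutoff.
have := norm_Loo_ae vL; apply: filterS; first exact: (ae_filter_ringOfSetsType mu).
by move=> xi vxi Ixi; rewrite /cutoff vxi// mul1r.
Qed.

Lemma component_final_state x :
  pr (final_state T v x) = final_value T (cutoff L v) x.
Proof.
rewrite /final_state prM pr_integral /final_value -mulrA; congr (_ * _).
(* The kernel carries the factor x that [final_state] keeps outside the integral; moving it inside
   goes through division by x. *)
have [->|x0] := eqVneq x 0.
  rewrite mul0r; under eq_Rintegral do rewrite /heat_kernel mul0r mul0r.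
  by rewrite Rintegral_cst// mul0r.
rewrite (@eq_Rintegral _ _ R mu _ (fun xi => (x^-1 * heat_kernel x xi) * pr (v xi))); last first.
  by move=> xi _; rewrite prM /heat_kernel mulKf.
rewrite integral_cutoff; last first.
  by apply: measurable_funM => //; exact: measurable_heat_kernel.
under eq_Rintegral do rewrite -mulrA.
rewrite RintegralZl; first by rewrite mulVKf.
  by [].
exact: (integrable_heat_kernelM T_gt0 measurable_cutoff (fun xi _ => cutoff_bounded xi)).
Qed.

End bounded_control.

(** The moments only see x > 0, where the convergence for real controls applies to the cut-off
    components. Oddness of W and of the final states carries it over to x < 0, reflection preserving
    null sets, and the point 0 is null. *)
Lemma component_cvg_ae (T L : R) (W : R -> R[i]) (v : nat -> R -> R[i]) :
  0 < T -> 0 <= L -> Cmeasurable setT W ->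
  {ae mu, forall x, W (- x) = - W x} ->
  (\int[mu]_(x in `]0%R, +oo[) (expR (x ^+ 2 / (4 * (4 * T))) * normc (W x))%:E < +oo)%E ->
  (forall N, Cmeasurable `]0, T[ (v N)) ->
  (forall N, (norm_Loo T (v N) <= L%:E)%E) ->
  (forall n N, (n <= N)%N ->
     Cintegral `]0, T[ (fun xi => (xi ^+ n)%:C * v N xi) = omega W n) ->
  {ae mu, forall x, pr (final_state T (v N) x) @[N --> \oo] --> pr (W x)}.
Proof.
move=> T0 L0 mW oddW Wlty mv vL vW.
pose u N := cutoff L (v N).
have FE N x : pr (final_state T (v N) x) = final_value T (u N) x.
  exact: component_final_state.
have meas_u N : measurable_fun `]0, T[ (u N) by exact: measurable_cutoff.
have uL N xi : `]0, T[%classic xi -> `|u N xi| <= L by move=> _; exact: cutoff_bounded.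
have mprW : measurable_fun setT (fun x => pr (W x)) by exact: pr_measurable.
have mX n : measurable_fun setT (fun x : R => x ^+ n) by exact: measurable_funX.
have uw n N : (n <= N)%N -> \int[mu]_(xi in `]0, T[) (xi ^+ n * u N xi) = pr (omega W n).
  move=> nN; rewrite -(vW n N nN) pr_integral -(integral_cutoff (mv N) (vL N)); last first.
    exact: measurable_funTS.
  by apply: eq_Rintegral => xi _; rewrite prM.
have iW : mu.-integrable `]0, +oo[
    (EFin \o (fun x => expR ((16 * T)^-1 * x ^+ 2) * pr (W x))).
  have c16 x : expR ((16 * T)^-1 * x ^+ 2) = expR (x ^+ 2 / (4 * (4 * T))) :> R.
    have -> : 16 * T = 4 * (4 * T) by ring.
    by rewrite mulrC.
  have me : measurable_fun setT (fun x : R => expR (x ^+ 2 / (4 * (4 * T)))).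
    by apply: measurableT_comp => //; apply: measurable_funM => //; exact: mX.
  have mn : measurable_fun setT (fun x => normc (W x)) by exact: measurable_normc.
  apply: (@dominated_integrable_real _ _ _ mu _ _
    (fun x => expR (x ^+ 2 / (4 * (4 * T))) * normc (W x))).
  - exact: measurable_itv.
  - apply: measurable_funTS; apply: measurable_funM mprW.
    apply: measurableT_comp => //; apply: measurable_funM => //; exact: mX.
  - by move=> x _; rewrite c16 normrM (ger0_norm (expR_ge0 _)) ler_wpM2l ?expR_ge0.
  - apply/integrableP; split.
      by apply/measurable_EFinP; apply: measurable_funTS; exact: measurable_funM.
    move: Wlty; apply: le_lt_trans; rewrite le_eqVlt; apply/orP; left; apply/eqP.
    apply: eq_integral => x _ /=.
    by rewrite ger0_norm// mulr_ge0 ?expR_ge0 ?normc_nneg.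
have hw n : \int[mu]_(x in `]0, +oo[) (x ^+ (2 * n + 1) * pr (W x)) =
    (2 * n + 1)`!%:R / n`!%:R * pr (omega W n).
  rewrite /omega prM pr_integral mulrA.
  rewrite (_ : _ / _ * (_ / _) = 1) ?mul1r; last first.
    by field; rewrite !pnatr_eq0 -!lt0n !fact_gt0.
  by apply: eq_Rintegral => x _; rewrite prM.
have pos : {ae mu, forall x, 0 < x -> final_value T (u N) x @[N --> \oo] --> pr (W x)}.
  exact: (final_value_cvg_ae T0 meas_u uL uw mprW iW hw).
have null0 : {ae mu, forall x, x <> 0}.
  exists [set 0]; split; [exact: measurable_set1|exact: lebesgue_measure_set1|].
  by move=> x /= /contrapT.
apply: filterS (filterI null0 (filterI pos (filterI (ae_opp pos) oddW)));
  try exact: (ae_filter_ringOfSetsType mu).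
move=> x [/eqP x0 [posx [negx oddx]]].
rewrite (_ : (fun N => _) = fun N => final_value T (u N) x); last first.
  by apply/funext => N; rewrite FE.
move: x0; rewrite neq_lt => /orP[xneg|xpos]; last exact: posx.
have /negx : 0 < - x by rewrite oppr_gt0.
rewrite oddx prN => /cvgN; rewrite opprK; apply: cvg_trans.
rewrite (_ : (fun N => final_value T (u N) x) = - (fun N => final_value T (u N) (- x)))//.
apply/funext => N; rewrite fctE (final_valueN T0 (meas_u N) (uL N)) opprK//.
Qed.

End component.

(** * The L^2 norm, and final states of complex controls as odd square-integrable functions *)

Lemma norm_L2E (R : realType) (f : R -> R[i]) :
  norm_L2 f = ((\int[@lebesgue_measure R]_x (normc (f x) ^+ 2)%:E) `^ 2^-1)%E.
Proof.
rewrite /norm_L2 unlock /Lnorm; congr (_ `^ _)%E; apply: eq_integral => x _ /=.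
by rewrite powR_mulrn// ger0_norm ?normc_nneg.
Qed.

Lemma norm_L2_lt (R : realType) (f : R -> R[i]) (e : R) : 0 < e ->
  (\int[@lebesgue_measure R]_x (normc (f x) ^+ 2)%:E < (e ^+ 2)%:E)%E ->
  (norm_L2 f < e%:E)%E.
Proof.
move=> e0 fe; rewrite norm_L2E.
have I0 : (0 <= \int[@lebesgue_measure R]_x (normc (f x) ^+ 2)%:E)%E.
  by apply: integral_ge0 => x _; rewrite lee_fin sqr_ge0.
have /fineK <- : (\int[@lebesgue_measure R]_x (normc (f x) ^+ 2)%:E)%E \is a fin_num.
  by rewrite ge0_fin_numE// (lt_trans fe)// ltry.
set I := fine _ in fe *.
rewrite poweR_EFin lte_fin powR12_sqrt ?fine_ge0//.
rewrite -[ltRHS]ger0_norm ?(ltW e0)// -sqrtr_sqr ltr_sqrt ?exprn_gt0//.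
by rewrite -lte_fin fineK// ge0_fin_numE// (lt_trans fe)// ltry.
Qed.

Lemma Re_integral (R : realType) (D : set R) (f : R -> R[i]) :
  complex.Re (Cintegral D f) = \int[@lebesgue_measure R]_(x in D) complex.Re (f x).
Proof. by []. Qed.

Lemma Im_integral (R : realType) (D : set R) (f : R -> R[i]) :
  complex.Im (Cintegral D f) = \int[@lebesgue_measure R]_(x in D) complex.Im (f x).
Proof. by []. Qed.

Section final_state.
Variables (R : realType) (T L : R) (v : R -> R[i]).
Notation mu := (@lebesgue_measure R).
Hypothesis T_gt0 : 0 < T.
Hypothesis L_ge0 : 0 <= L.
Hypothesis mv : Cmeasurable `]0, T[ v.
Hypothesis vL : (norm_Loo T v <= L%:E)%E.

Let mRe D f : Cmeasurable D f -> measurable_fun D (fun x => complex.Re (f x) : R).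
Proof. by case. Qed.
Let mIm D f : Cmeasurable D f -> measurable_fun D (fun x => complex.Im (f x) : R).
Proof. by case. Qed.

Let ReE x : complex.Re (final_state T v x) =
    final_value T (cutoff (@complex.Re R) L v) x.
Proof.
exact: (component_final_state (@Re_le_normc R) (@Re_realM R) (@Re_integral R)).
Qed.

Let ImE x : complex.Im (final_state T v x) =
    final_value T (cutoff (@complex.Im R) L v) x.
Proof.
exact: (component_final_state (@Im_le_normc R) (@Im_realM R) (@Im_integral R)).
Qed.

Let mcRe := measurable_cutoff (pr := @complex.Re R) mRe L mv.
Let mcIm := measurable_cutoff (pr := @complex.Im R) mIm L mv.
Let cReL := cutoff_bounded (@Re_le_normc R) v L_ge0.
Let cImL := cutoff_bounded (@Im_le_normc R) v L_ge0.

Lemma Cmeasurable_final_state : Cmeasurable setT (final_state T v).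
Proof.
split.
  rewrite (funext ReE).
  exact: (measurable_final_value T_gt0 mcRe (fun x _ => cReL x)).
rewrite (funext ImE).
exact: (measurable_final_value T_gt0 mcIm (fun x _ => cImL x)).
Qed.

Lemma final_stateN x : final_state T v (- x) = - final_state T v x.
Proof.
apply/eqP; rewrite eq_complex; apply/andP; split; apply/eqP.
  rewrite ReE (final_valueN T_gt0 mcRe (fun x _ => cReL x)) -ReE.
  by case: (final_state T v x).
rewrite ImE (final_valueN T_gt0 mcIm (fun x _ => cImL x)) -ImE.
by case: (final_state T v x).
Qed.

Lemma Re_final_state_le x : `|complex.Re (final_state T v x)| <=
  Num.sqrt (2 / pi) * L * 64 * expR (- ((8 * T)^-1 * x ^+ 2)).
Proof. by rewrite ReE; exact: (final_value_le T_gt0 mcRe (fun x _ => cReL x)). Qed.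

Lemma Im_final_state_le x : `|complex.Im (final_state T v x)| <=
  Num.sqrt (2 / pi) * L * 64 * expR (- ((8 * T)^-1 * x ^+ 2)).
Proof. by rewrite ImE; exact: (final_value_le T_gt0 mcIm (fun x _ => cImL x)). Qed.

Lemma norm_L2_final_state_lty : (norm_L2 (final_state T v) < +oo)%E.
Proof.
pose C : R := Num.sqrt (2 / pi) * L * 64.
have a0 : 0 < 2 * (8 * T)^-1 by rewrite mulr_gt0 ?invr_gt0 ?mulr_gt0.
have iG : mu.-integrable setT
    (EFin \o (fun x => (2 * C ^+ 2) * expR (- (2 * (8 * T)^-1 * x ^+ 2)))).
  by have /(integrableZl _ (2 * C ^+ 2)) := integrable_gauss a0; apply.
have : mu.-integrable setT (EFin \o (fun x => normc (final_state T v x) ^+ 2)).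
  apply: (dominated_integrable_real _ _ _ iG).
  - exact: measurableT.
  - apply: measurable_funX; apply: measurable_normc; first exact: measurableT.
    exact: Cmeasurable_final_state.
  - move=> x _; rewrite ger0_norm ?sqr_ge0// sqr_normcE.
    have h1 := Re_final_state_le x; have h2 := Im_final_state_le x.
    have -> : expR (- (2 * (8 * T)^-1 * x ^+ 2)) = expR (- ((8 * T)^-1 * x ^+ 2)) ^+ 2.
      by rewrite -expRM_natl; congr expR; ring.
    have sq (p b : R) : `|p| <= b -> p ^+ 2 <= b ^+ 2 by rewrite ler_norml => /andP[]; nra.
    rewrite -mulrA -exprMn mulr_natl mulr2n; apply: lerD; exact: sq.
move=> /integrableP[_]; rewrite norm_L2E => fin; apply: poweR_lty.
move: fin; apply: le_lt_trans; rewrite le_eqVlt; apply/orP; left; apply/eqP.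
by apply: eq_integral => x _; rewrite /= ger0_norm ?sqr_ge0.
Qed.

Lemma scalar_in_final_state (K : scalar_field) x :
  (forall t, scalar_in K (v t)) -> scalar_in K (final_state T v x).
Proof.
case: K => // v0; have Imv t : complex.Im (v t) = 0 := v0 t.
rewrite /scalar_in /final_state Im_realM Im_integral.
under eq_Rintegral do rewrite Im_realM Imv mulr0.
by rewrite Rintegral_cst// mul0r mulr0.
Qed.

End final_state.

Theorem theorem4p5 (R : realType) (K : scalar_field) (T L : R)
    (T_gt0 : 0 < T) (L_gt0 : 0 < L) (W : R -> R[i]) (W_odd : odd_L2 K W)
    (W_bound : forall T' : R, T < T' ->
      (\int[@lebesgue_measure R]_(x in `]0%R, +oo[)
         (expR (x ^+ 2 / (4 * T')) * normc (W x))%:E <=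
       (L * Num.sqrt (T' / pi) *
         ln ((Num.sqrt T' + Num.sqrt T) / (Num.sqrt T' - Num.sqrt T)))%:E)%E)
    (W_moments : forall N : nat, exists v : R -> R[i],
      [/\ Loo K T v, (norm_Loo T v <= L%:E)%E &
          forall n : nat, (n <= N)%N ->
            Cintegral `]0, T[ (fun xi => (xi ^+ n)%:C * v xi) = omega W n]) :
  closure_odd_L2 K (reachable0 K T L) W.
Proof.
have [v vP] := choice W_moments; set mu := @lebesgue_measure R.
have L_ge0 := ltW L_gt0.
have mv N : Cmeasurable `]0, T[ (v N) by case: (vP N) => -[].
have vL N : (norm_Loo T (v N) <= L%:E)%E by case: (vP N).
have vW n N : (n <= N)%N ->
    Cintegral `]0, T[ (fun xi => (xi ^+ n)%:C * v N xi) = omega W n.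
  by case: (vP N) => _ _; exact.
have [_ mW _ oddW] := W_odd.
have Wlty : (\int[mu]_(x in `]0%R, +oo[)
    (expR (x ^+ 2 / (4 * (4 * T))) * normc (W x))%:E < +oo)%E.
  (* At T' = 4 T the weight is exp (x^2 / (16 T)), the one matched to the decay of the final states;
     the finiteness of the bound is what is extracted. *)
  by apply: le_lt_trans (W_bound (4 * T) _) _; rewrite ?ltry// ltr_pMl// ltr1n.
pose F N := final_state T (v N).
have mF N : Cmeasurable setT (F N) by exact: (Cmeasurable_final_state T_gt0 L_ge0 (mv N) (vL N)).
have cRe : {ae mu, forall x, complex.Re (F N x) @[N --> \oo] --> complex.Re (W x)}.
  apply: (component_cvg_ae (@Re_le_normc R) (@Re_realM R) _ (@Re_integral R) _
    T_gt0 L_ge0 mW oddW Wlty mv vL vW); first by case.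
  by move=> D f [].
have cIm : {ae mu, forall x, complex.Im (F N x) @[N --> \oo] --> complex.Im (W x)}.
  apply: (component_cvg_ae (@Im_le_normc R) (@Im_realM R) _ (@Im_integral R) _
    T_gt0 L_ge0 mW oddW Wlty mv vL vW); first by case.
  by move=> D f [].
pose C : R := Num.sqrt (2 / pi) * L * 64.
pose E x : R := expR (- ((8 * T)^-1 * x ^+ 2)).
have FRe N x : `|complex.Re (F N x)| <= C * E x by exact: (Re_final_state_le T_gt0 L_ge0 (mv N) (vL N)).
have FIm N x : `|complex.Im (F N x)| <= C * E x by exact: (Im_final_state_le T_gt0 L_ge0 (mv N) (vL N)).
have lim_le (f : nat -> R) (l b : R) : f N @[N --> \oo] --> l ->
    (forall N, `|f N| <= b) -> `|l| <= b.
  move=> fl fb.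
  have nfl : `|f N| @[N --> \oo] --> `|l|.
    exact: cvg_norm fl.
  rewrite -(cvg_lim (@Rhausdorff R) nfl); apply: limr_le; last exact: nearW.
  by apply/cvg_ex; exists `|l|.
have cvg_sqrB (f : nat -> R) (l : R) : f N @[N --> \oo] --> l ->
    (l - f N) ^+ 2 @[N --> \oo] --> (0 : R).
  move=> fl; have d : l - f N @[N --> \oo] --> l - l by exact: cvgB (cvg_cst l) fl.
  by rewrite subrr in d; rewrite -[X in _ --> X](mulr0 0); exact: (cvgM d d).
pose g N x : R := normc (W x - F N x) ^+ 2.
have gE N x : g N x = (complex.Re (W x) - complex.Re (F N x)) ^+ 2 +
    (complex.Im (W x) - complex.Im (F N x)) ^+ 2.
  by rewrite /g sqr_normcE; case: (W x) => a b; case: (F N x).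
have mg N : measurable_fun setT (g N).
  rewrite (funext (gE N)); have [mW1 mW2] := mW; have [mF1 mF2] := mF N.
  by apply: measurable_funD; apply: measurable_funX; exact: measurable_funB.
have a0 : 0 < 2 * (8 * T)^-1 by rewrite mulr_gt0 ?invr_gt0 ?mulr_gt0.
(* The majorant of the squared error: each component of W and of F N is at most C E, so each squared
   difference is at most 4 (C E)^2, and there are two components. *)
have iG : mu.-integrable setT
    (EFin \o (fun x => (8 * C ^+ 2) * expR (- (2 * (8 * T)^-1 * x ^+ 2)))).
  by have /(integrableZl _ (8 * C ^+ 2)) := integrable_gauss a0; apply.
have E2 x : expR (- (2 * (8 * T)^-1 * x ^+ 2)) = E x ^+ 2.
  by rewrite -expRM_natl; congr expR; ring.
have [_ _] : [/\ mu.-integrable setT (cst 0%E),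
    (fun N => \int[mu]_x `|(g N x)%:E - 0|)%E @ \oo --> 0%E &
    (fun N => \int[mu]_x (g N x)%:E)%E @ \oo --> (\int[mu]_x (0 : \bar R))%E].
  apply: (@dominated_convergence _ _ _ mu setT measurableT (fun N => EFin \o g N)
    (cst 0%E) _ _ _ _ iG).
  - by move=> N; apply/measurable_EFinP; exact: mg.
  - exact: measurable_cst.
  - apply: filterS (filterI cRe cIm); try exact: (ae_filter_ringOfSetsType mu).
    move=> x [reW imW] _; apply: cvg_EFin; first exact: nearW.
    rewrite (_ : _ \o _ = fun N => (complex.Re (W x) - complex.Re (F N x)) ^+ 2 +
      (complex.Im (W x) - complex.Im (F N x)) ^+ 2); last first.
      by apply/funext => N /=; rewrite gE.
    rewrite -[X in _ --> X](addr0 0).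
    exact: (cvgD (cvg_sqrB _ _ reW) (cvg_sqrB _ _ imW)).
  - apply: filterS (filterI cRe cIm); try exact: (ae_filter_ringOfSetsType mu).
    move=> x [reW imW] N _ /=.
    (* W has no pointwise bound by hypothesis; it inherits that of the final states as their almost
       everywhere limit. *)
    have WRe := lim_le _ _ _ reW (FRe^~ x).
    have WIm := lim_le _ _ _ imW (FIm^~ x).
    rewrite ger0_norm ?sqr_ge0// lee_fin gE E2 -mulrA -exprMn.
    have sq (p q b : R) : `|p| <= b -> `|q| <= b -> (p - q) ^+ 2 <= 4 * b ^+ 2.
      by rewrite !ler_norml => /andP[p1 p2] /andP[q1 q2]; nra.
    have h1 := sq _ _ _ WRe (FRe N x); have h2 := sq _ _ _ WIm (FIm N x).
    by move: h1 h2; lra.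
rewrite integral0 => /fine_cvgP[fin_near cv].
split => // e e0.
have e20 : 0 < e ^+ 2 by rewrite exprn_gt0.
move/cvgrPdist_lt : cv => /(_ _ e20) near_e.
have [N _ /(_ N (leqnn N))[gfin glt]] := filterI fin_near near_e.
exists (F N).
  have [[vK _ _] _ _] := vP N.
  split; last by exists (v N); split => //; [by case: (vP N)|exact: nearW].
  split.
  - by move=> x; exact: scalar_in_final_state.
  - exact: mF.
  - exact: (norm_L2_final_state_lty T_gt0 L_ge0 (mv N) (vL N)).
  - by apply: nearW => x; exact: (final_stateN T_gt0 L_ge0 (mv N) (vL N)).
apply: norm_L2_lt => //; rewrite -(fineK gfin) lte_fin.
by move: glt; rewrite /= sub0r normrN; apply: le_lt_trans; exact: ler_norm.
Qed.
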